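(* For $k\ge1$ let $P_k$ be the $k$-th Legendre polynomial and $\varphi_k(x)=\sqrt{2k+1}\,P_k(2x-1)$, $x\in[0,1]$. Set $\alpha_k=1$ if $k$ is odd and $\alpha_k=|\min_{[-1,1]}P_k|$ if $k$ is even. Let $(\lambda_k)_{k\ge1}$ be real numbers with $$\sum_k\lambda_k^2<\infty,\qquad \sup_k|\lambda_k|<1,\qquad \sum_k|\lambda_k|(2k+1)\alpha_k\le1,$$ and let $C$ be a copula of the form $$C(u,v)=uv+\sum_{k=1}^\infty\lambda_k\int_0^u\varphi_k(x)\,dx\int_0^v\varphi_k(y)\,dy.$$ Then for all large enough $n$ a version of the density $c^n(u,v)$ of $C^n$ is bounded above by a constant $M<2$. Therefore $C$ generates $\psi^*$-mixing (equivalently, for stationary Markov chains, $\psi$-mixing) stationary Markov chains for all such values of its parameters.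
   Context: Legendre polynomials: $P_k(x)=\frac{1}{2^kk!}\frac{d^k}{dx^k}(x^2-1)^k$. A (bivariate) copula is the restriction to $[0,1]^2$ of a bivariate cumulative distribution function with uniform marginals. Powers: $C^1=C$, $C^n(u,v)=\int_0^1C^{n-1}_{,2}(u,t)C_{,1}(t,v)\,dt$, where $C_{,i}$ is the partial derivative in the $i$-th variable; $c^n$ is the density of $C^n$ (not a power of $c$). A version of a function is any function equal to it off a Lebesgue-null set. The stationary Markov chain $(U_n)_{n\ge0}$ generated by $C$ has $U_n$ uniform on $(0,1)$ and $(U_n,U_{n+1})$ with joint distribution function $C$. With $P(A)=P(U_0\in A)$, $P^n(A\cap B)=P(U_0\in A,U_n\in B)$ for Borel $A,B$, $$\psi_n=\sup_{P(A)P(B)>0}\frac{|P^n(A\cap B)-P(A)P(B)|}{P(A)P(B)},\qquad \psi^*_n=\sup_{P(A)P(B)>0}\frac{P^n(A\cap B)}{P(A)P(B)}.$$ The chain is $\psi$-mixing if $\psi_n\to0$ and $\psi^*$-mixing if $\psi_n^*\to1$. *)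

(* Defs.v *)
From HB Require Import structures.
From mathcomp Require Import all_boot all_order all_algebra.
From mathcomp Require Import all_classical all_reals all_analysis.

Set Implicit Arguments.
Unset Strict Implicit.
Unset Printing Implicit Defensive.

Import Order.TTheory GRing.Theory Num.Theory.
Import numFieldNormedType.Exports.

Local Open Scope classical_set_scope.
Local Open Scope ring_scope.

Section Legendre.
Variable R : realType.

Definition legendre (k : nat) : {poly R} :=
  ((2 ^ k * k`!)%N%:R)^-1 *: (('X^2 - 1) ^+ k)^`(k).

Definition varphi (k : nat) (x : R) : R :=
  Num.sqrt (2 * k + 1)%N%:R * (legendre k).[2 * x - 1].

(* A polynomial attains its infimum on [-1, 1], so [inf] is the minimum. *)
Definition alpha (k : nat) : R :=
  if odd k then 1 else `|inf [set (legendre k).[x] | x in `[-1, 1]]|.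

End Legendre.

Section Copula.
Variable R : realType.
Implicit Types C : R -> R -> R.

(* Bivariate functions are total on R * R, but only their values on the unit
   square [0, 1]^2 matter: [derive1] is two-sided, so outside values can enter
   a partial derivative only at an endpoint, which no integral over [0, 1]
   sees. *)
Definition copula C : Prop :=
  exists mu : probability (measurableTypeR R * measurableTypeR R)%type R,
    [/\ forall A : set R, measurable A ->
          mu (A `*` [set: R]) = uniform_prob (@ltr01 R) A,
        forall B : set R, measurable B ->
          mu ([set: R] `*` B) = uniform_prob (@ltr01 R) B
      & forall u v : R, u \in `[0, 1] -> v \in `[0, 1] ->
          (C u v)%:E = mu (`]-oo, u] `*` `]-oo, v])].

Definition D1 C (u v : R) : R := derive1 (C ^~ v) u.
Definition D2 C (u v : R) : R := derive1 (C u) v.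

Definition copula_mul A B (u v : R) : R :=
  \int[lebesgue_measure]_(t in `[0, 1]) (D2 A u t * D1 B t v).

(* C^1 = C and C^(n+1) = C^n * C; the value C at n = 0 is a dummy. *)
Definition copula_pow C (n : nat) : R -> R -> R :=
  iter n.-1 (copula_mul ^~ C) C.

Definition legendre_copula (lambda : nat -> R) C : Prop :=
  forall u v : R, u \in `[0, 1] -> v \in `[0, 1] ->
    u * v + \sum_(1 <= k < N) lambda k
        * (\int[lebesgue_measure]_(x in `[0, u]) varphi k x)
        * (\int[lebesgue_measure]_(y in `[0, v]) varphi k y)
      @[N --> \oo] --> C u v.

Definition unit_square : set (measurableTypeR R * measurableTypeR R) :=
  `[0, 1] `*` `[0, 1].

Definition lebesgue2 :
    {measure set (measurableTypeR R * measurableTypeR R) -> \bar R} :=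
  (@lebesgue_measure R \x @lebesgue_measure R)%E.

Definition is_density (c : measurableTypeR R * measurableTypeR R -> R) C : Prop :=
  [/\ measurable_fun unit_square c,
      forall z, unit_square z -> 0 <= c z
    & forall u v : R, u \in `[0, 1] -> v \in `[0, 1] ->
        (C u v)%:E = (\int[lebesgue2]_(z in `[0%R, u] `*` `[0%R, v]) (c z)%:E)%E].

Definition is_version (g c : measurableTypeR R * measurableTypeR R -> R) : Prop :=
  {ae lebesgue2, forall z, unit_square z -> g z = c z}.

End Copula.

Section MarkovChain.
Context (d : measure_display) (T : measurableType d) (R : realType)
  (P : probability T R).

Definition sigma_rv (X : {RV P >-> R}) : set (set T) :=
  preimage_set_system [set: T] X measurable.

Definition sigma_past (U : nat -> {RV P >-> R}) (n : nat) : set (set T) :=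
  <<s \bigcup_(i in `I_n.+1) sigma_rv (U i) >>.

Definition is_cond_prob (G : set (set T)) (E : set T) (Y : T -> R) : Prop :=
  [/\ preimage_set_system [set: T] Y measurable `<=` G,
      P.-integrable [set: T] (EFin \o Y)
    & forall F, G F -> (\int[P]_(w in F) (Y w)%:E)%E = P (F `&` E)].

(* P(U_(n+1) \in B | U_0, ..., U_n) = P(U_(n+1) \in B | U_n) almost surely,
   expressed as: the two conditional probabilities have a common version. *)
Definition markov_property (U : nat -> {RV P >-> R}) : Prop :=
  forall (n : nat) (B : set R), measurable B ->
    exists Y : T -> R,
      is_cond_prob (sigma_past U n) (U n.+1 @^-1` B) Y
      /\ is_cond_prob (sigma_rv (U n)) (U n.+1 @^-1` B) Y.

(* Strict stationarity follows from these clauses, the law of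
   (U_n, U_(n+1)) being the same for all n. *)
Definition chain_generated_by (C : R -> R -> R) (U : nat -> {RV P >-> R}) :
    Prop :=
  [/\ markov_property U,
      forall (n : nat) (A : set R), measurable A ->
        distribution P (U n) A = uniform_prob (@ltr01 R) A
    & forall (n : nat) (u v : R), u \in `[0, 1] -> v \in `[0, 1] ->
        P (U n @^-1` `]-oo, u] `&` U n.+1 @^-1` `]-oo, v]) = (C u v)%:E].

Definition Pr (U : nat -> {RV P >-> R}) (A : set R) : R :=
  fine (P (U 0%N @^-1` A)).

Definition Prn (U : nat -> {RV P >-> R}) (n : nat) (A B : set R) : R :=
  fine (P (U 0%N @^-1` A `&` U n @^-1` B)).

Definition nonnull_pairs (U : nat -> {RV P >-> R}) : set (set R * set R) :=
  [set AB | [/\ measurable AB.1, measurable AB.2 & 0 < Pr U AB.1 * Pr U AB.2]].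

Definition psi (U : nat -> {RV P >-> R}) (n : nat) : \bar R :=
  ereal_sup [set (`|Prn U n AB.1 AB.2 - Pr U AB.1 * Pr U AB.2|
                  / (Pr U AB.1 * Pr U AB.2))%:E | AB in nonnull_pairs U].

Definition psi_star (U : nat -> {RV P >-> R}) (n : nat) : \bar R :=
  ereal_sup [set (Prn U n AB.1 AB.2 / (Pr U AB.1 * Pr U AB.2))%:E
            | AB in nonnull_pairs U].

Definition psi_mixing (U : nat -> {RV P >-> R}) : Prop :=
  psi U n @[n --> \oo] --> 0%E.

Definition psi_star_mixing (U : nat -> {RV P >-> R}) : Prop :=
  psi_star U n @[n --> \oo] --> 1%E.

End MarkovChain.

(* Main.v *)
(** With phi_k = varphi_k orthonormal on [0, 1] and phi_0 = 1, the copula powers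
    are C^n(u,v) = sum_k l_k^n Phi_k(u) Phi_k(v), where Phi_k is the primitive of
    phi_k, l_0 = 1 and l_k = lambda_k, so that for n >= 2 the density is
    1 + sum_(k >= 1) lambda_k^n phi_k(x) phi_k(y).  Since |phi_k| <= sqrt(2k+1), the
    sum is at most sup |lambda|^(n-2) times sum_k lambda_k^2 (2k+1), and the latter
    is at most 1 as soon as |lambda_k| <= alpha_k.  This follows from
    |lambda_k| (2k+1) alpha_k <= 1 and the lower bound (2k+1) alpha_k^2 >= 1.  For
    even k that bound comes from Sonin's function
    k(k+1) P_k^2 + (1-x^2) P_k'^2, which increases with |x| by Legendre's equation:
    comparing the minimiser of P_k with 0 gives alpha_k >= |P_k(0)|, a central
    binomial coefficient over 2^k.

    For the chain, fix the event E = {U_0 in A}.  By the Markov property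
    P(E, U_(n+1) <= v) = E[1_E C_(,1)(U_n, v)], so the coefficients
    E[1_E phi_k(U_n)] are multiplied by l_k at each step, and the law of U_n
    restricted to E has density sum_k l_k^n E[1_E phi_k(U_0)] phi_k, which is within
    sup |lambda|^(n-2) P(E) of P(E). *)

Require Import Defs.
From HB Require Import structures.
From mathcomp Require Import all_boot all_order all_algebra.
From mathcomp Require Import all_classical all_reals all_analysis.
From mathcomp Require Import measurable_realfun ring lra zify polyrcf.

Set Implicit Arguments.
Unset Strict Implicit.
Unset Printing Implicit Defensive.

Import Order.TTheory GRing.Theory Num.Theory.
Import numFieldNormedType.Exports.

Local Open Scope classical_set_scope.
Local Open Scope ring_scope.

(** * Formal primitives and integrals of polynomials *)

Section PolynomialPrimitive.
Variable R : realType.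
Implicit Types (p q F : {poly R}) (a b x : R).

Lemma deriv_factor a q n :
  (('X - a%:P) ^+ n.+1 * q)^`() =
  ('X - a%:P) ^+ n * (n.+1%:R *: q + ('X - a%:P) * q^`()).
Proof.
rewrite derivM deriv_exp derivXsubC exprSr scaler_nat -mulr_natl mul1r.
by rewrite -[q *+ _]mulr_natl; ring.
Qed.

Lemma root_derivn_factor a q (n j : nat) : (j < n)%N ->
  ((('X - a%:P) ^+ n * q)^`(j)).[a] = 0.
Proof.
elim: j n q => [|j IH] [//|n] q jn.
  by rewrite derivn0 exprS !hornerE subrr !mul0r.
by rewrite derivSn deriv_factor IH.
Qed.

(** By [deriv_factor], each differentiation trades one power of [X - a] for an integer factor, up to
    a term that still vanishes at [a]. After [n] of them the factors have accumulated to [n!]. *)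
Lemma horner_derivn_factor a q (n : nat) :
  ((('X - a%:P) ^+ n * q)^`(n)).[a] = n`!%:R * q.[a].
Proof.
elim: n q => [|n IH] q; first by rewrite derivn0 expr0 mul1r mul1r.
rewrite derivSn deriv_factor IH !hornerE subrr mul0r addr0 factS natrM.
by ring.
Qed.

(** At [i = 0] the coefficient is a quotient by zero, hence [0]: this is the primitive that vanishes
    at the origin. *)
Definition prim p : {poly R} := \poly_(i < (size p).+1) (p`_i.-1 / i%:R).

Lemma deriv_prim p : (prim p)^`() = p.
Proof.
apply/polyP => i; rewrite coef_deriv coef_poly ltnS /=.
case: ltnP => ip; last by rewrite mul0rn nth_default.
by rewrite -[LHS]mulr_natr divfK// pnatr_eq0.
Qed.

Lemma deriv_eq0_const p x y : p^`() = 0 -> p.[x] = p.[y].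
Proof.
move=> p0; suff -> : p = (p`_0)%:P by rewrite !hornerC.
apply/polyP => -[|i]; rewrite coefC//=.
have := congr1 (fun q : {poly R} => q`_i) p0.
rewrite coef_deriv coef0 -mulr_natr => /eqP; rewrite mulf_eq0 pnatr_eq0 orbF.
by move/eqP.
Qed.

(** The integral from [a] to [b] taken algebraically, so that orthogonality is obtained without
    measure theory; [Rintegral_poly] makes the link with the Lebesgue integral. *)
Definition pint p a b := (prim p).[b] - (prim p).[a].

Lemma pintE F p a b : F^`() = p -> pint p a b = F.[b] - F.[a].
Proof.
move=> Fp; rewrite /pint; have : (prim p - F)^`() = 0.
  by rewrite derivB deriv_prim Fp subrr.
move/(@deriv_eq0_const _ a b); rewrite !hornerE => h.
by lra.
Qed.

Lemma pintD p q a b : pint (p + q) a b = pint p a b + pint q a b.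
Proof.
rewrite (@pintE (prim p + prim q)) ?derivD ?deriv_prim//.
by rewrite !(hornerD, hornerZ) /pint; ring.
Qed.

Lemma pintZ c p a b : pint (c *: p) a b = c * pint p a b.
Proof.
rewrite (@pintE (c *: prim p)) ?derivZ ?deriv_prim//.
by rewrite !(hornerD, hornerZ) /pint; ring.
Qed.

Lemma pint_comp p a b c d : c != 0 ->
  pint (p \Po (c *: 'X + d%:P)) a b = c^-1 * pint p (c * a + d) (c * b + d).
Proof.
move=> c0; rewrite (@pintE (c^-1 *: (prim p \Po (c *: 'X + d%:P)))).
  by rewrite !hornerE !horner_comp !hornerE /pint; ring.
rewrite derivZ deriv_comp deriv_prim derivD derivZ derivX derivC addr0.
by rewrite -scalerAr mulr1 scalerA mulVf// scale1r.
Qed.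

End PolynomialPrimitive.

(** * Legendre polynomials: differential equation, bounds, orthogonality *)

Section LegendrePolynomials.
Variable R : realType.
Local Notation P := (legendre R).

Let w k : {poly R} := ('X^2 - 1) ^+ k.
Let nrm k : R := ((2 ^ k * k`!)%N%:R)^-1.

Let nrm0 k : ((2 ^ k * k`!)%N%:R : R) != 0.
Proof. by rewrite pnatr_eq0 -lt0n muln_gt0 expn_gt0 fact_gt0. Qed.

Let w1 k : w k = ('X - 1%:P) ^+ k * ('X - (-1)%:P) ^+ k.
Proof. by rewrite -exprMn /w; congr (_ ^+ _); rewrite polyCN; ring. Qed.

(** In Rodrigues' formula with [(X - 1)^k] split off, the [k]-th derivative at [1] is [k! 2^k],
    which the normalisation cancels. *)
Lemma legendre1 k : (P k).[1] = 1.
Proof.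
rewrite /legendre -/(w k) w1 hornerZ horner_derivn_factor horner_exp hornerXsubC.
by rewrite opprK -[1 + 1]/(2%:R) -natrX mulrC -natrM mulnC divff ?nrm0.
Qed.

Lemma legendreN1 k : (P k).[-1] = (-1) ^+ k.
Proof.
rewrite /legendre -/(w k) w1 mulrC hornerZ horner_derivn_factor horner_exp.
have -> : ('X - 1%:P).[-1] = -1 * 2%:R :> R by rewrite hornerXsubC; ring.
rewrite exprMn natrM natrX.
have h1 : 2%:R ^+ k != 0 :> R by rewrite expf_neq0.
have h2 : (k`!)%:R != 0 :> R by rewrite pnatr_eq0 -lt0n fact_gt0.
by field; rewrite h1 h2.
Qed.

(** The first-order identity [(X^2 - 1) w' = 2 k X w] differentiated [m + 1] times. At [m = k] the
    two coefficients become [-2] and [k (k + 1)], which is Legendre's equation. *)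
Let w_ode k m : ('X^2 - 1) * (w k)^`(m.+2) =
  (k%:R *+ 2 - m.+1%:R *+ 2) * 'X * (w k)^`(m.+1) +
  m.+1%:R * (k%:R *+ 2 - m%:R) * (w k)^`(m).
Proof.
have dQ : ('X^2 - 1 : {poly R})^`() = 'X *+ 2.
  by rewrite derivB derivXn derivC subr0 expr1.
have dn (n : nat) : (n%:R : {poly R})^`() = 0 by rewrite derivMn derivC mul0rn.
have base : ('X^2 - 1) * (w k)^`() = k%:R *+ 2 * 'X * w k.
  case: k => [|k]; first by rewrite /w expr0 derivC mulr0 mul0rn !mul0r.
  rewrite /w deriv_exp dQ [in RHS]exprS /= -[X in _ * X = _]mulr_natl.
  by ring.
elim: m => [|m IH].
  have := congr1 (@deriv _) base; rewrite derivSn derivn1 derivn0.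
  rewrite !derivM dQ derivMn dn derivX mul0rn => h.
  have {h} := canRL (addKr _) h => ->; ring.
have := congr1 (@deriv _) IH.
rewrite [X in X = _]derivM dQ derivD !derivM !derivB !derivMn (derivC 1) derivX.
rewrite -!derivnS !mul0rn => h.
have {h} := canRL (addKr _) h => ->.
rewrite -[m.+2]addn1 -[m.+1]addn1 !natrD; ring.
Qed.

Lemma legendre_ode k : (1 - 'X^2) * (P k)^`()^`() =
  'X * (P k)^`() *+ 2 - (k * k.+1)%:R * P k.
Proof.
have := w_ode k k; rewrite natrM /legendre -/(w k) !derivZ.
rewrite -!mul_polyC -derivnS -derivnS => h.
rewrite [RHS](_ : _ = - ((nrm k)%:P * (
  (k%:R *+ 2 - k.+1%:R *+ 2) * 'X * (w k)^`(k.+1) +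
  k.+1%:R * (k%:R *+ 2 - k%:R) * (w k)^`(k)))); last first.
  by rewrite -[k.+1]addn1 natrD /nrm; ring.
by rewrite -h /nrm; ring.
Qed.

Let sonin k : {poly R} :=
  (k * k.+1)%:R * P k ^+ 2 + (1 - 'X^2) * (P k)^`() ^+ 2.

(** Legendre's equation eliminates the second derivative. What remains has the sign of [x], which
    gives the two monotonicity lemmas that follow. *)
Let deriv_sonin k : (sonin k)^`() = 'X * (P k)^`() ^+ 2 *+ 2.
Proof.
have dn (n : nat) : (n%:R : {poly R})^`() = 0 by rewrite derivMn derivC mul0rn.
rewrite /sonin derivD [X in X + _]derivM [X in _ + X]derivM !deriv_exp dn.
rewrite derivB derivXn derivC /= !expr1.
set D := (_^`())^`(); have /= h := legendre_ode k; rewrite -/D in h.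
rewrite [LHS](_ : _ = ((k * k.+1)%:R * P k + (1 - 'X^2) * D - 'X * (P k)^`())
  * (P k)^`() *+ 2); last by ring.
by rewrite h; ring.
Qed.

Let sonin_le k (a b : R) : 0 <= a -> a <= b -> (sonin k).[a] <= (sonin k).[b].
Proof.
move=> a0; rewrite le_eqVlt => /predU1P[->//|ab].
have [c /[!in_itv]/= /andP[ac cb]] := poly_mvt (sonin k) ab.
move=> h; rewrite -subr_ge0 h deriv_sonin -mulrnAl.
rewrite mulr_ge0 ?subr_ge0 ?(ltW ab)// hornerM hornerMn hornerX horner_exp.
by rewrite mulr_ge0 ?sqr_ge0// mulrn_wge0// ltW// (le_lt_trans a0).
Qed.

Let sonin_ge k (a b : R) : b <= 0 -> a <= b -> (sonin k).[b] <= (sonin k).[a].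
Proof.
move=> b0; rewrite le_eqVlt => /predU1P[->//|ab].
have [c /[!in_itv]/= /andP[ac cb]] := poly_mvt (sonin k) ab.
move=> h; rewrite -subr_le0 h deriv_sonin -mulrnAl.
rewrite mulr_le0_ge0 ?subr_ge0 ?(ltW ab)// hornerM hornerMn hornerX horner_exp.
by rewrite mulr_le0_ge0 ?sqr_ge0// mulrn_wle0// ltW// (lt_le_trans cb).
Qed.

Let soninE k x :
  (sonin k).[x] = (k * k.+1)%:R * (P k).[x] ^+ 2 + (1 - x ^+ 2) * (P k)^`().[x] ^+ 2.
Proof.
by rewrite /sonin !(hornerD, hornerM, hornerN, hornerMn, hornerC, hornerX); ring.
Qed.

(** Sonin's function is largest at the endpoints, where its second term vanishes and [P_k^2 = 1]. *)
Let sonin_le1 k x : -1 <= x <= 1 -> (sonin k).[x] <= (k * k.+1)%:R.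
Proof.
move=> /andP[x1 x2]; have [x0|/ltW x0] := leP 0 x.
  apply: le_trans (sonin_le k x0 x2) _; rewrite soninE legendre1.
  by rewrite expr1n subrr mul0r addr0 mulr1.
apply: le_trans (sonin_ge k x0 x1) _; rewrite soninE legendreN1.
by rewrite sqrrN expr1n subrr mul0r addr0 exprAC sqrrN expr1n expr1n mulr1.
Qed.

Let kk_gt0 k : (0 < k)%N -> 0 < (k * k.+1)%:R :> R.
Proof. by move=> k0; rewrite ltr0n muln_gt0 k0. Qed.

Lemma legendre00 x : (P 0).[x] = 1.
Proof.
by rewrite /legendre derivn0 expr0 expn0 fact0 mul1n invr1 scale1r hornerC.
Qed.

Lemma legendre_le1 k x : -1 <= x <= 1 -> `|(P k).[x]| <= 1.
Proof.
move=> x11; have [->|k0] := posnP k.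
  by rewrite legendre00 normr1.
rewrite -(@ler_pXn2r _ 2)// ?nnegrE// expr1n real_normK ?num_real//.
have := sonin_le1 k x11; rewrite soninE => h.
rewrite -(@ler_pM2l _ (k * k.+1)%:R) ?kk_gt0// mulr1; apply: le_trans h.
rewrite lerDl mulr_ge0 ?sqr_ge0// subr_ge0.
by have -> : x ^+ 2 <= 1 by nra.
Qed.

(* An interior minimum is a critical point, where Sonin's function is
   [k (k + 1) P_k ^ 2]; its value at [0] is at least [k (k + 1) P_k(0) ^ 2]. *)
Lemma alpha_ge_legendre0 k : ~~ odd k -> (P k).[0] ^+ 2 <= alpha R k ^+ 2.
Proof.
move=> ek; have [->|k0] := posnP k.
  rewrite legendre00 expr1n /alpha /=.
  rewrite (_ : [set _ | _ in _] = [set 1]) ?inf1 ?normr1 ?expr1n//.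
  apply/seteqP; split => [_ [x _ <-]|_ ->]/=; first by rewrite legendre00.
  by exists 0; rewrite ?legendre00// in_itv/=; lra.
rewrite /alpha (negbTE ek).
have cP : {within `[(-1 : R), 1], continuous (fun x => (P k).[x])}.
  by apply: continuous_subspaceT => x; exact: continuous_horner.
have N11 : -1 <= 1 :> R by lra.
have [c c11 cmin] := EVT_min N11 cP.
have -> : inf [set (P k).[x] | x in `[-1, 1]] = (P k).[c].
  apply/eqP; rewrite eq_le; apply/andP; split.
    by apply: ge_inf; [exists (P k).[c] => _ [x /= x11 <-]; exact: cmin|exists c].
  apply: lb_le_inf; first by exists (P k).[c], c.
  by move=> _ [x /= x11 <-]; exact: cmin.
rewrite real_normK ?num_real//.
have c0 : (sonin k).[0] <= (sonin k).[c].
  have [c0|/ltW c0] := leP 0 c; first exact: sonin_le.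
  exact: sonin_ge.
(* If the minimum is at an endpoint, [P_k^2] equals [1] there and [legendre_le1] at [0] is
   enough. *)
move: c11; rewrite in_itv/= => /andP[]; rewrite le_eqVlt => /predU1P[<- _|Nc].
  rewrite legendreN1 -signr_odd (negbTE ek) expr0 expr1n.
  by rewrite -[leLHS]ger0_norm ?sqr_ge0// normrX expr_le1// legendre_le1//; lra.
rewrite le_eqVlt => /predU1P[->|c1].
  rewrite legendre1 expr1n.
  by rewrite -[leLHS]ger0_norm ?sqr_ge0// normrX expr_le1// legendre_le1//; lra.
have P'c : (P k)^`().[c] = 0.
  have h : is_derive c 1 (horner (P k)) 0.
    apply: (@derive1_at_min _ _ (-1) 1) => //; first by rewrite in_itv/= Nc.
    by move=> t t11; apply: cmin; exact: subset_itv_oo_cc.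
  by case: h => _ <-; case: (is_derive_poly (P k) c) => _ <-.
rewrite -(@ler_pM2l _ (k * k.+1)%:R) ?kk_gt0//.
have := soninE k c; rewrite P'c expr0n mulr0 addr0 => <-.
apply: le_trans c0.
by rewrite soninE expr0n subr0 mul1r lerDl sqr_ge0.
Qed.

(** The value at [0] is, up to sign, the central binomial coefficient over [4^m]; it is then bounded
    below without Stirling's formula. *)
Lemma legendre0_sqr_ge m : (0 < m)%N -> (4 * m)%:R^-1 <= (P m.*2).[0] ^+ 2.
Proof.
move=> m0.
(* In the binomial expansion of [(X^2 - 1)^(2m)] only the middle term has degree [2m]. *)
have wc : (w m.*2)`_(m.*2) = (-1) ^+ m * 'C(m.*2, m)%:R.
  have mm : (m < m.*2.+1)%N by rewrite ltnS -addnn leq_addl.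
  rewrite /w exprDn coef_sum (bigD1 (Ordinal mm)) //= big1 ?addr0 => [|i im].
    rewrite coefMn -exprM -polyCN -polyC_exp coefMC coefXn -addnn addnK mul2n -addnn eqxx.
    by rewrite mul1r mulr_natr.
  rewrite coefMn -exprM -polyCN -polyC_exp coefMC coefXn mul2n.
  case: eqP => [h|]; last by rewrite mul0r mul0rn.
  case/eqP: im; apply/val_inj => /=; move: h; case: i => i /= + h; lia.
have c0 : 'C(m.*2, m)%:R != 0 :> R.
  by rewrite pnatr_eq0 -lt0n bin_gt0 -addnn leq_addl.
have -> : (P m.*2).[0] = (-1) ^+ m * 'C(m.*2, m)%:R / 2 ^+ m.*2.
  rewrite /legendre -/(w _) hornerZ horner_coef0 coef_derivn addn0 wc ffactnn.
  rewrite natrM natrX -mulr_natr.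
  have h2 : (m.*2`!)%:R != 0 :> R by rewrite pnatr_eq0 -lt0n fact_gt0.
  by field; rewrite h2 expf_neq0.
(* Induction from equality at [m = 1]. With the shifted index, the step reduces to
   [4 (m + 1) (m + 2) <= (2m + 3)^2]. *)
have bound : (16 ^ m <= 4 * m * 'C(m.*2, m) ^ 2)%N.
  case: m m0 {wc c0} => // m _; elim: m => // m IH.
  have h1 := mul_bin_diag m.+2.*2 m.+1.
  have h2 := mul_bin_down m.*2.+3 m.+1.
  rewrite doubleS /= in h1 IH *; rewrite /= in h2.
  set B := 'C(m.*2.+2, m.+1) in h2 IH; set B1 := 'C(m.*2.+3, m.+1) in h1 h2.
  set B2 := 'C(m.*2.+4, m.+2) in h1 *.
  have {}h1 : B2 = (2 * B1)%N by move: h1; rewrite -mul2n; nia.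
  have {}h2 : ((2 * m + 3) * B = (m + 2) * B1)%N by move: h2; nia.
  rewrite h1 [(16 ^ m.+2)%N]expnS.
  have {}IH : (16 * 16 ^ m.+1 <= 16 * (4 * m.+1 * B ^ 2))%N by rewrite leq_mul2l IH orbT.
  apply: leq_trans IH _.
  rewrite -(@leq_pmul2l (m + 2)) ?addn2//.
  have : ((m + 2) ^ 2 * B1 ^ 2 = (2 * m + 3) ^ 2 * B ^ 2)%N.
    by rewrite -!expnMn h2.
  by nia.
rewrite expr_div_n exprMn sqrr_sign mul1r -exprM -muln2 mulnC.
rewrite ler_pdivlMr ?exprn_gt0// mulrC ler_pdivrMr ?ltr0n ?muln_gt0 ?m0//.
have -> : (2 : R) ^+ (m * 2 * 2) = (16 ^ m)%N%:R.
  by rewrite -mulnA mulnC exprM [RHS]natrX -natrX.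
have b2 : (16 ^ m)%N%:R <= (4 * m * 'C(m.*2, m) ^ 2)%N%:R :> R by rewrite ler_nat.
by apply: le_trans b2 _; rewrite muln2 !natrM; lra.
Qed.

(** For [k = 2m > 0] the two factors give at least [(4m + 1) / (4m)]; odd [k] and [k = 0] are
    immediate. *)
Lemma alpha_sqr_ge k : 1 <= (2 * k + 1)%:R * alpha R k ^+ 2.
Proof.
have [ok|ek] := boolP (odd k).
  by rewrite /alpha ok expr1n mulr1 ler1n addn1.
apply: le_trans (ler_wpM2l (ler0n _ _) (alpha_ge_legendre0 ek)).
rewrite -[k]odd_double_half (negbTE ek) add0n; case: k./2 => [|m].
  by rewrite legendre00 expr1n mulr1.
apply: le_trans (ler_wpM2l (ler0n _ _) (@legendre0_sqr_ge m.+1 isT)).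
by rewrite ler_pdivlMr ?ltr0n// mul1r ler_nat -mul2n mulnA leq_addr.
Qed.

Lemma alpha_ge0 k : 0 <= alpha R k.
Proof. by rewrite /alpha; case: ifP. Qed.

(** Integration by parts, [j] times. The boundary terms vanish because [w k] has zeros of order [k]
    at both ends, and each step lowers the degree of [q] until [q = 0]. *)
Let pint_lt k j (q : {poly R}) : (j <= k)%N -> (size q <= j)%N ->
  pint (q * (w k)^`(j)) (-1) 1 = 0.
Proof.
elim: j q => [|j IH] q jk sq.
  rewrite (_ : q = 0); last by apply/eqP; rewrite -size_poly_eq0 -leqn0.
  by rewrite mul0r (@pintE _ 0) ?deriv0// !horner0 subrr.
have -> : q * (w k)^`(j.+1) = (q * (w k)^`(j))^`() + (-1) *: (q^`() * (w k)^`(j)).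
  by rewrite derivM derivnS scaleN1r addrAC subrr add0r.
rewrite pintD pintZ IH ?mulr0 ?addr0; last 2 first.
- exact: ltnW.
- have [->|q0] := eqVneq q 0; first by rewrite deriv0 size_poly0.
  by rewrite -ltnS (leq_trans _ sq)// lt_size_deriv.
rewrite (pintE _ _ erefl) !hornerM.
rewrite {1}w1 (root_derivn_factor _ _ jk).
rewrite (_ : w k = ('X - (-1)%:P) ^+ k * ('X - 1%:P) ^+ k).
  by rewrite (root_derivn_factor _ _ jk) !mulr0 subrr.
by rewrite w1 mulrC.
Qed.

Lemma pint_legendre_lt k (q : {poly R}) : (size q <= k)%N ->
  pint (q * P k) (-1) 1 = 0.
Proof.
by move=> sq; rewrite /legendre -scalerAr pintZ pint_lt// mulr0.
Qed.

Lemma size_legendre k : (size (P k) <= k.+1)%N.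
Proof.
apply: leq_trans (size_scale_leq _ _) _; apply/leq_sizeP => j kj.
rewrite coef_derivn nth_default ?mul0rn//.
apply: leq_trans (size_exp_leq _ _) _.
rewrite -polyC1 size_XnsubC//= mul2n -addnn; lia.
Qed.

Lemma pint_legendre k j :
  pint (P k * P j) (-1) 1 = (k == j)%:R * (2%:R / (2 * k + 1)%:R).
Proof.
have [->|] := eqVneq k j; last first.
  rewrite neq_ltn mul0r => /orP[kj|jk].
    by rewrite pint_legendre_lt// (leq_trans (size_legendre _)).
  by rewrite mulrC pint_legendre_lt// (leq_trans (size_legendre _)).
rewrite mul1r.
(* The leading terms of [X P_j'] and [j P_j] cancel, so [q] is orthogonal to [P_j]. Integrating the
   derivative of [X P_j^2] then gives the squared norm from boundary values alone. *)
pose q := 'X * (P j)^`() - j%:R *: P j.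
have sq : (size q <= j)%N.
  apply/leq_sizeP => i ji; rewrite coefB coefXM coefZ coef_deriv.
  case: i ji => [|i] ji /=.
    by move: ji; rewrite leqn0 => /eqP ->; rewrite mul0r subrr.
  move: ji; rewrite leq_eqVlt => /predU1P[->|ji]; first by rewrite mulr_natl subrr.
  by rewrite nth_default ?mul0rn ?mulr0 ?subrr// (leq_trans (size_legendre _)).
have e : ('X * (P j * P j))^`() =
    (2 * j + 1)%:R *: (P j * P j) + 2%:R *: (q * P j).
  rewrite derivM derivX derivM /q natrD natrM -!mul_polyC !polyCD !polyCM.
  by rewrite !polyC_natr; ring.
have := pintE (-1) 1 e; rewrite pintD !pintZ (pint_legendre_lt sq) mulr0 addr0.
rewrite !hornerM !hornerX legendre1 legendreN1 -expr2 -exprMn mulrNN mulr1 expr1n.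
move=> h; apply: (@mulfI _ (2 * j + 1)%:R); first by rewrite pnatr_eq0 addn1.
by rewrite h mulrCA divff ?pnatr_eq0 ?addn1//; ring.
Qed.

End LegendrePolynomials.

(** * Dominated series and termwise integration *)

Section DominatedSeries.
Variable R : realType.
Implicit Types (f a : nat -> R).

Lemma series_dominated_cvg f a : (forall k, `|f k| <= a k) ->
  cvgn (series a) -> cvgn (series f).
Proof.
move=> fa ca; apply: normed_cvg; apply: (series_le_cvg _ _ fa ca) => //.
by move=> n; rewrite (le_trans _ (fa n)).
Qed.

Lemma series_dominated_le f a : (forall k, `|f k| <= a k) ->
  cvgn (series a) -> `|limn (series f)| <= limn (series a).
Proof.
move=> fa ca; have a0 n : 0 <= a n by rewrite (le_trans _ (fa n)).
have cn : cvgn [normed series f] by apply: (series_le_cvg _ a0 fa ca).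
by apply: le_trans (lim_series_norm cn) _; exact: lim_series_le.
Qed.

Lemma norm_series_le f a n : (forall k, `|f k| <= a k) ->
  cvgn (series a) -> `|series f n| <= limn (series a).
Proof.
move=> fa ca; have a0 k : 0 <= a k by rewrite (le_trans _ (fa k)).
apply: (@le_trans _ _ (series a n)).
  rewrite /series/=; apply: le_trans (ler_norm_sum _ _ _) _.
  by apply: ler_sum => k _; exact: fa.
apply: nondecreasing_cvgn_le => //.
by apply: nondecreasing_series => k _ _; exact: a0.
Qed.

(** Weierstrass' test: the right-hand side depends on [a] only, so the estimate is uniform in any
    parameter of [f]. *)
Lemma series_tail_le f a n : (forall k, `|f k| <= a k) ->
  cvgn (series a) ->
  `|limn (series f) - series f n| <= limn (series a) - series a n.
Proof.
move=> fa ca; have cf := series_dominated_cvg fa ca.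
have a0 k : 0 <= a k by rewrite (le_trans _ (fa k)).
apply: (@ler_cvg_to _ \oo _ R (fun m => `|series f m - series f n|)
  (fun m => series a m - series a n)).
- by apply: cvg_norm; apply: cvgB; [exact: cf|exact: cvg_cst].
- by apply: cvgB; [exact: ca|exact: cvg_cst].
near=> m.
rewrite !sub_series_geq; [|near: m; exact: nbhs_infty_ge..].
apply: le_trans (ler_norm_sum _ _ _) _.
by apply: ler_sum => k _; exact: fa.
Unshelve. all: by end_near. Qed.

Lemma cvg_seriesMr f (l b : R) : series f @ \oo --> l ->
  series (fun k => f k * b) @ \oo --> l * b.
Proof.
move=> fl; have -> : series (fun k => f k * b) = (fun n => series f n * b).
  by apply/funext => n; rewrite /series /= mulr_suml.
by apply: cvgM => //; exact: cvg_cst.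
Qed.

Section Integral.
Context d (T : measurableType d) (mu : {measure set T -> \bar R}).
Implicit Type D : set T.

Lemma bounded_integrable D (g : T -> R) (M : R) : measurable D -> (mu D < +oo)%E ->
  measurable_fun D g -> (forall x, D x -> `|g x| <= M) ->
  mu.-integrable D (EFin \o g).
Proof.
move=> mD muD mg gM.
apply: (@le_integrable _ _ _ mu D mD _ (EFin \o cst M)).
- exact/measurable_EFinP.
- move=> x Dx /=; rewrite lee_fin (le_trans (gM x Dx))// ler_norm//.
- by apply/integrableP; split; [exact/measurable_EFinP|
    rewrite /= integral_cst//; rewrite lte_mul_pinfty].
Qed.

(** From [|g| <= (1 + g^2) / 2]. On a probability space with [g] of norm one the bound is [1], which
    replaces the Cauchy-Schwarz inequality. *)
Lemma normr_Rintegral_le_sqr D (E : set T) (g : T -> R) (M : R) :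
  measurable D -> measurable E -> D `<=` E -> (mu E < +oo)%E ->
  measurable_fun E g -> (forall x, E x -> `|g x| <= M) ->
  `|\int[mu]_(x in D) g x| <= (fine (mu E) + \int[mu]_(x in E) (g x * g x)) / 2.
Proof.
move=> mD mE DE muE mg gM.
have ig : mu.-integrable E (EFin \o g).
  by apply: (bounded_integrable (M := M)).
have iDg : mu.-integrable D (EFin \o g) by exact: integrableS ig.
have ing : mu.-integrable E (EFin \o (fun x => `|g x|)) by exact: integrable_norm.
have igg : mu.-integrable E (EFin \o (fun x => g x * g x)).
  apply: (bounded_integrable (M := M ^+ 2)) => //; first exact: measurable_funM.
  by move=> x Ex; rewrite normrM -expr2 lerXn2r ?nnegrE ?gM// (le_trans _ (gM x Ex)).
have i1 : mu.-integrable E (EFin \o (fun=> 1 : R)).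
  by apply: (bounded_integrable (M := 1)) => // x _; rewrite normr1.
apply: le_trans (le_normr_Rintegral mD iDg) _.
apply: (@le_trans _ _ (\int[mu]_(x in E) `|g x|)).
  apply: fine_le; first exact: integrable_fin_num (integrable_norm iDg).
    exact: integrable_fin_num.
  apply: ge0_subset_integral => //; apply/measurable_EFinP.
  exact: measurableT_comp.
have -> : fine (mu E) = \int[mu]_(x in E) 1 by rewrite Rintegral_cst// mul1r.
have isum : mu.-integrable E (EFin \o (fun x => 1 + g x * g x)).
  exact: (integrableD mE i1 igg).
rewrite -RintegralD// -RintegralZr//.
apply: le_Rintegral => //; first exact: (integrableZr mE _ isum).
move=> x _; have := sqr_ge0 (`|g x| - 1); rewrite sqrrB1 real_normK ?num_real//.
by rewrite expr2; lra.
Qed.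

(** Dominated convergence, with the constant sum of [a] as majorant on a set of finite measure. *)
Lemma integral_series D (f : nat -> T -> R) (a : nat -> R) :
  measurable D -> (mu D < +oo)%E ->
  (forall k, measurable_fun D (f k)) ->
  (forall k x, D x -> `|f k x| <= a k) -> cvgn (series a) ->
  [/\ measurable_fun D (fun x => limn (series (f ^~ x))),
      mu.-integrable D (EFin \o (fun x => limn (series (f ^~ x)))) &
      series (fun k => \int[mu]_(x in D) f k x) @ \oo -->
        \int[mu]_(x in D) limn (series (f ^~ x))].
Proof.
move=> mD muD mf fa ca; set g := fun x => _.
have mS n : measurable_fun D (fun x => series (f ^~ x) n).
  by apply: measurable_sum => k; exact: mf.
have Sg x : D x -> series (f ^~ x) @ \oo --> g x.
  by move=> Dx; apply: (@series_dominated_cvg _ a) => // k; exact: fa.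
have mg : measurable_fun D g by exact: measurable_fun_cvg Sg.
have gM x : D x -> `|g x| <= limn (series a).
  by move=> Dx; apply: series_dominated_le => // k; exact: fa.
have ig : mu.-integrable D (EFin \o g) by exact: bounded_integrable gM.
split => //.
have im : mu.-integrable D (EFin \o cst (limn (series a))).
  apply: (bounded_integrable (M := `|limn (series a)|)) => //.
have [||||_ _ h] := @dominated_convergence _ _ _ mu D mD
  (fun n x => (series (f ^~ x) n)%:E) (EFin \o g) _ _ _ _ im.
- by move=> n; apply/measurable_EFinP.
- exact/measurable_EFinP.
- by apply: aeW => x Dx; apply/fine_cvgP; split; [exact: nearW|exact: Sg].
- apply: aeW => x n Dx; rewrite /= lee_fin norm_series_le// => k; exact: fa.
have fi k : mu.-integrable D (EFin \o f k).
  by apply: (bounded_integrable (M := a k)) => // x; exact: fa.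
rewrite -[X in _ --> X]fineK in h; last exact: integrable_fin_num.
move/fine_cvg : h; apply: cvg_trans; apply: near_eq_cvg; apply: nearW => n /=.
rewrite /series/=; under eq_integral do rewrite -sumEFin.
rewrite integral_sum// (eq_bigr (fun k => (\int[mu]_(x in D) f k x)%:E)).
  by rewrite sumEFin.
by move=> k _; rewrite [RHS]fineK//; exact: (integrable_fin_num mD (fi k)).
Qed.

End Integral.
End DominatedSeries.

(** * The orthonormal system on the unit interval *)

Section ShiftedLegendre.
Variable R : realType.
Local Notation mu := (@lebesgue_measure R).
Implicit Types (p : {poly R}) (k j : nat).

Definition lpoly k : {poly R} :=
  Num.sqrt (2 * k + 1)%:R *: (legendre R k \Po (2%:R *: 'X + (-1)%:P)).

Lemma varphiE k (x : R) : varphi k x = (lpoly k).[x].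
Proof.
rewrite /lpoly [RHS]hornerZ horner_comp; congr (_ * _.[_]).
by rewrite hornerD hornerZ hornerX hornerC.
Qed.

Lemma Rintegral_poly p (a b : R) : a <= b ->
  \int[mu]_(x in `[a, b]) p.[x] = pint p a b.
Proof.
rewrite le_eqVlt => /predU1P[<-|ab].
  by rewrite set_itv1 Rintegral_set1 /pint subrr.
rewrite /Rintegral (@continuous_FTC2 _ _ (horner (prim p)))//.
- by apply: continuous_subspaceT => x; exact: continuous_horner.
- split => [x _||].
  + by have [] := is_derive_poly (prim p) x.
  + by apply: cvg_at_right_filter; exact: continuous_horner.
  + by apply: cvg_at_left_filter; exact: continuous_horner.
- by move=> x _; rewrite -derivE deriv_prim.
Qed.

(** Composition with this projection makes [phi k] continuous and bounded on the whole line, so that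
    the series built from it need no restriction of domain. *)
Definition unit_clamp (x : R) : R := Num.max 0 (Num.min x 1).

Lemma unit_clamp_in x : 0 <= unit_clamp x <= 1.
Proof. by rewrite /unit_clamp le_max lexx/= ge_max ler01/= ge_min lexx orbT. Qed.

Lemma unit_clamp_id x : 0 <= x <= 1 -> unit_clamp x = x.
Proof. by move=> /andP[x0 x1]; rewrite /unit_clamp (min_idPl x1) (max_idPr x0). Qed.

Lemma continuous_unit_clamp : continuous unit_clamp.
Proof.
move=> x; apply: (@continuous_max R R (fun=> 0) (fun x => Num.min x 1)).
  exact: cvg_cst.
apply: (@continuous_min R R id (fun=> 1)); first exact: cvg_id.
exact: cvg_cst.
Qed.

Definition phi k (x : R) : R := varphi k (unit_clamp x).
(** The supremum of [|phi k|], attained at [1]. *)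
Definition wgt k : R := Num.sqrt (2 * k + 1)%:R.
Definition Phi k (u : R) : R := \int[mu]_(x in `[0, u]) varphi k x.

Lemma phi_id k x : 0 <= x <= 1 -> phi k x = varphi k x.
Proof. by move=> x01; rewrite /phi unit_clamp_id. Qed.

Lemma continuous_phi k : continuous (phi k).
Proof.
move=> x; rewrite /phi.
have -> : varphi k = horner (lpoly k) by apply/funext => y; rewrite varphiE.
apply: continuous_comp; first exact: continuous_unit_clamp.
exact: continuous_horner.
Qed.

Lemma wgt_ge0 k : 0 <= wgt k. Proof. exact: sqrtr_ge0. Qed.

Lemma wgt_sqr k : wgt k * wgt k = (2 * k + 1)%:R.
Proof. by rewrite -expr2 sqr_sqrtr. Qed.

Lemma wgt_ge1 k : 1 <= wgt k.
Proof. by rewrite -[leLHS]sqrtr1 ler_sqrt// ler1n addn1. Qed.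

Lemma phi_le k x : `|phi k x| <= wgt k.
Proof.
rewrite /phi /varphi normrM ger0_norm ?sqrtr_ge0//.
rewrite ler_piMr ?sqrtr_ge0// legendre_le1//.
by have /andP[h1 h2] := unit_clamp_in x; lra.
Qed.

Lemma phi0 x : phi 0 x = 1.
Proof. by rewrite /phi /varphi legendre00 mulr1 sqrtr1. Qed.

(** The substitution [2x - 1] halves the integral, and the factor [wgt k ^ 2 = 2k + 1] cancels the
    squared norm [2 / (2k + 1)]. *)
Lemma phi_orthonormal j k :
  \int[mu]_(x in `[0, 1]) (phi j x * phi k x) = (j == k)%:R.
Proof.
transitivity (\int[mu]_(x in `[0, 1]) (lpoly j * lpoly k).[x]).
  apply: eq_Rintegral => x; rewrite inE/= in_itv/= => x01.
  by rewrite hornerM -!varphiE !phi_id.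
rewrite Rintegral_poly// /lpoly -!scalerAl -!scalerAr.
rewrite !pintZ -comp_polyM pint_comp ?pnatr_eq0//.
rewrite [2 * 0 + -1](_ : _ = -1); last by ring.
rewrite [2 * 1 + -1](_ : _ = 1); last by ring.
rewrite pint_legendre; have [->|jk] := eqVneq j k; last by rewrite !mul0r !mulr0.
rewrite -/(wgt k); set s := wgt k.
have n0 : (2 * k + 1)%:R != 0 :> R by rewrite pnatr_eq0 addn1.
transitivity (s * s / (2 * k + 1)%:R); last by rewrite wgt_sqr divff.
by rewrite (_ : (true : nat)%:R = 1 :> R)//; field; move: n0; rewrite natrD natrM.
Qed.

Lemma PhiE k u : 0 <= u <= 1 -> Phi k u = \int[mu]_(x in `[0, u]) phi k x.
Proof.
move=> /andP[u0 u1]; apply: eq_Rintegral => x; rewrite inE/= in_itv/= => /andP[x0 xu].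
by rewrite phi_id// x0 (le_trans xu).
Qed.

Lemma Phi0 u : 0 <= u <= 1 -> Phi 0 u = u.
Proof.
move=> u01; rewrite PhiE//; under eq_Rintegral do rewrite phi0.
rewrite Rintegral_cst//= lebesgue_measure_itv/= lte_fin mul1r.
case: ltP => u0; first by rewrite -EFinD /= subr0.
by apply/eqP; rewrite eq_le u0 (andP u01).1.
Qed.

Lemma lebesgue_unit : mu `[0%R, 1%R] = 1%E.
Proof. by rewrite lebesgue_measure_itv/= lte_fin ltr01 -EFinD subr0. Qed.

(** A consequence of [phi k] having norm one. Independence of [k] matters: [spectrum_summable]
    multiplies these numbers by a single factor [l k]. *)
Lemma normr_Phi_le1 k u : 0 <= u <= 1 -> `|Phi k u| <= 1.
Proof.
move=> /[dup] u01 /andP[u0 u1]; rewrite PhiE//.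
have h := @normr_Rintegral_le_sqr _ _ _ mu `[0, u] `[0, 1] (phi k) (wgt k).
apply: (le_trans (h _ _ _ _ _ _)) => //.
- by apply: subset_itvl; rewrite bnd_simp.
- by rewrite [ltLHS](_ : _ = 1%E) ?ltry//; exact: lebesgue_unit.
- apply: measurable_funTS; apply: continuous_measurable_fun.
  exact: continuous_phi.
- by move=> x _; exact: phi_le.
rewrite phi_orthonormal eqxx (_ : fine _ = 1) /=; last first.
  by transitivity (fine (1%E : \bar R)) => //; congr fine; exact: lebesgue_unit.
by lra.
Qed.

End ShiftedLegendre.

(** * Absolutely summable Legendre series *)

Section LegendreSeries.
Variable R : realType.
Local Notation mu := (@lebesgue_measure R).
Implicit Types (c : nat -> R) (k j : nat).

(** Summability against the sup norms of the [phi k], which makes the series converge uniformly. *)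
Definition legendre_summable c := cvgn (series (fun k => `|c k| * wgt R k)).

Definition lseries c (t : R) : R := limn (series (fun k => c k * phi k t)).

Lemma phi_term_le c t k : `|c k * phi k t| <= `|c k| * wgt R k.
Proof. by rewrite normrM ler_wpM2l// phi_le. Qed.

Lemma lseries_le c t : legendre_summable c ->
  `|lseries c t| <= limn (series (fun k => `|c k| * wgt R k)).
Proof. by move=> cc; apply: series_dominated_le => // k; exact: phi_term_le. Qed.

(** A uniform limit of continuous partial sums, by the usual division of [e] into three parts. *)
Lemma continuous_lseries c : legendre_summable c -> continuous (lseries c).
Proof.
move=> cc t; apply/cvgrPdist_le => e e0.
pose a k := `|c k| * wgt R k.
have e3 : 0 < e / 3 by rewrite divr_gt0.
have [N _ hN] := (cvgrPdist_le _ _).1 cc _ e3.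
have {}hN : limn (series a) - series a N <= e / 3.
  by apply: le_trans (ler_norm _) (hN N _) => /=.
pose p x := series (fun k => c k * phi k x) N.
have tail x : `|lseries c x - p x| <= e / 3.
  by apply: le_trans hN; apply: series_tail_le => // k; exact: phi_term_le.
have cp : {for t, continuous p}.
  rewrite /p /series /=; apply: cvg_big => [|k _]; first exact: add_continuous.
  by apply: cvgM; [exact: cvg_cst|exact: continuous_phi].
have h := (cvgrPdist_le _ _).1 cp _ e3; near=> x.
have px : `|p t - p x| <= e / 3 by near: x; exact: h.
have -> : lseries c t - lseries c x =
  (lseries c t - p t) + (p t - p x) - (lseries c x - p x) by ring.
have h1 := tail t; have h2 := tail x.
apply: le_trans (ler_normB _ _) _; have := ler_normD (lseries c t - p t) (p t - p x).
by lra.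
Unshelve. all: by end_near. Qed.

Lemma measurable_lseries c : legendre_summable c ->
  measurable_fun [set: R] (lseries c).
Proof.
by move=> cc; apply: continuous_measurable_fun; exact: continuous_lseries.
Qed.

Lemma measurable_phi k : measurable_fun [set: R] (@phi R k).
Proof. by apply: continuous_measurable_fun; exact: continuous_phi. Qed.

Lemma cvg_lseries c t : legendre_summable c ->
  series (fun k => c k * phi k t) @ \oo --> lseries c t.
Proof. by move=> cc; apply: series_dominated_cvg cc => k; exact: phi_term_le. Qed.

(** Stated for an arbitrary measure and map [X], it covers both Lebesgue integrals, with [X] the
    identity, and expectations of functions of the chain. *)
Lemma integral_lseries d (T : measurableType d) (m : {measure set T -> \bar R})
    (D : set T) (X g : T -> R) (M : R) c :
  measurable D -> (m D < +oo)%E -> measurable_fun D X -> measurable_fun D g ->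
  (forall x, D x -> `|g x| <= M) -> legendre_summable c ->
  series (fun k => c k * \int[m]_(x in D) (phi k (X x) * g x)) @ \oo -->
    \int[m]_(x in D) (lseries c (X x) * g x).
Proof.
move=> mD mDoo mX mg gM cc.
have mphi k : measurable_fun D (fun x => phi k (X x) * g x).
  apply: measurable_funM => //; apply: measurableT_comp => //.
  exact: measurable_phi.
have pM k x : D x -> `|phi k (X x) * g x| <= wgt R k * M.
  by move=> Dx; rewrite normrM ler_pM// ?phi_le// gM.
have [] := @integral_series R d T m D (fun k x => c k * (phi k (X x) * g x))
    (fun k => `|c k| * wgt R k * M) mD mDoo.
- by move=> k; apply: measurable_funM => //; exact: measurable_cst.
- by move=> k x Dx; rewrite normrM -mulrA ler_wpM2l// pM.
- by apply/cvg_ex; eexists; exact: cvg_seriesMr cc.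
move=> _ _; rewrite (_ : (fun k => _) =
    (fun k => c k * \int[m]_(x in D) (phi k (X x) * g x))); last first.
  apply/funext => k; rewrite RintegralZl//.
  by apply: (bounded_integrable (M := wgt R k * M)) => // x; exact: pM.
rewrite (_ : Rintegral _ _ _ = \int[m]_(x in D) (lseries c (X x) * g x))//.
apply: eq_Rintegral => x _; apply: cvg_lim => //.
rewrite (_ : (fun k => _) = fun k => c k * phi k (X x) * g x); last first.
  by apply/funext => k; rewrite mulrA.
by apply: cvg_seriesMr; exact: cvg_lseries.
Qed.

Lemma integral_lseries_cst d (T : measurableType d)
    (m : {measure set T -> \bar R}) (D : set T) (X : T -> R) c :
  measurable D -> (m D < +oo)%E -> measurable_fun D X -> legendre_summable c ->
  series (fun k => c k * \int[m]_(x in D) phi k (X x)) @ \oo -->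
    \int[m]_(x in D) lseries c (X x).
Proof.
move=> mD mDoo mX cc.
have := @integral_lseries d T m D X (fun=> 1) 1 c mD mDoo mX _ _ cc.
under [in X in series X]eq_fun do under eq_Rintegral do rewrite mulr1.
under [in X in _ --> X]eq_Rintegral do rewrite mulr1.
by apply; [exact: measurable_cst|move=> x _; rewrite normr1].
Qed.

Let unit_fin : (mu `[0%R, 1%R] < +oo)%E.
Proof. by rewrite lebesgue_unit ltry. Qed.

(** By orthonormality the series integrated against [phi k] has a single nonzero term, so its
    partial sums are eventually constant. *)
Lemma legendre_coef c k : legendre_summable c ->
  \int[mu]_(x in `[0, 1]) (lseries c x * phi k x) = c k.
Proof.
move=> cc; have mphi := measurable_funTS (@measurable_phi k).
have := @integral_lseries _ _ mu `[0, 1] id (phi k) (wgt R k) c _ unit_fin _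
  (mphi _) (fun x _ => phi_le k x) cc.
move=> /(_ _ _)/cvg_lim <- //.
apply: cvg_lim => //; apply: cvg_near_cst.
near=> n; rewrite /series/= (bigD1_seq k)/=; last 2 first.
- by rewrite mem_index_iota; near: n; exact: nbhs_infty_gt.
- exact: iota_uniq.
rewrite phi_orthonormal eqxx mulr1 big1 ?addr0// => j jk.
by rewrite phi_orthonormal (negbTE jk) mulr0.
Unshelve. all: by end_near. Qed.

(** Parseval's identity; through it the product of copulas multiplies the coefficients. *)
Lemma integral_lseriesM c c' : legendre_summable c -> legendre_summable c' ->
  series (fun k => c k * c' k) @ \oo -->
  \int[mu]_(x in `[0, 1]) (lseries c x * lseries c' x).
Proof.
move=> cc cc'.
have := @integral_lseries _ _ mu `[0, 1] id (lseries c') _ c _ unit_fin _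
  (measurable_funTS (measurable_lseries cc')) (fun x _ => lseries_le x cc') cc.
rewrite (_ : (fun k => c k * c' k) =
  (fun k => c k * \int[mu]_(x in `[0, 1]) (phi k x * lseries c' x))); last first.
  apply/funext => k; congr (_ * _); rewrite -(legendre_coef k cc').
  by apply: eq_Rintegral => x _; rewrite mulrC.
exact.
Qed.

Lemma integral_lseries_itv c u : legendre_summable c -> 0 <= u <= 1 ->
  series (fun k => c k * Phi k u) @ \oo --> \int[mu]_(x in `[0, u]) lseries c x.
Proof.
move=> cc u01; under eq_fun do rewrite PhiE//.
apply: (@integral_lseries_cst _ _ mu `[0, u] id) => //.
by rewrite [ltLHS]lebesgue_measure_itv/=; case: ifP => _; rewrite ?ltry// -EFinD ltry.
Qed.

(** The hypothesis identifies [F] on the unit interval with the integral of a continuous function.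
    The point is interior because the derivative is two-sided and [F] is arbitrary outside. *)
Lemma lseries_derive c (F : R -> R) u : legendre_summable c -> 0 < u < 1 ->
  (forall v, 0 <= v <= 1 -> series (fun k => c k * Phi k v) @ \oo --> F v) ->
  derive1 F u = lseries c u.
Proof.
move=> cc /andP[u0 u1] hF.
pose G (v : R) := \int[mu]_(x in `[0, v]) lseries c x.
have FG : \near u, F u = G u.
  near=> v; have v01 : 0 <= v <= 1.
    by apply/andP; split; near: v; [exact: lt_le_nbhsr|exact: lt_le_nbhsl].
  have <- := cvg_lim _ (hF v v01) => //.
  by apply: cvg_lim => //; exact: integral_lseries_itv.
transitivity (derive1 G u); first by rewrite !derive1E; exact: near_eq_derive.
have [] := @continuous_FTC1 _ (lseries c) (BLeft 0) u 1 u1.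
- apply: continuous_compact_integrable; first exact: segment_compact.
  by apply: continuous_subspaceT => x; exact: continuous_lseries.
- by [].
- exact: continuous_lseries.
- by [].
Unshelve. all: by end_near. Qed.

End LegendreSeries.

(** * Summability of the coefficients *)

Section LegendreCopula.
Variable R : realType.
Local Notation mu := (@lebesgue_measure R).
Implicit Types (l lambda b : nat -> R) (r : R) (C : R -> R -> R).

(** The [l k] are the eigenvalues of the transition operator, with [l 0 = 1] for the constants. The
    first sum controls the partial derivatives of the copula, the second the densities of its higher
    powers. *)
Definition contractive_spectrum l r : Prop :=
  [/\ l 0%N = 1, 0 <= r < 1, forall k, (0 < k)%N -> `|l k| <= r,
      forall n, \sum_(1 <= k < n) `|l k| * wgt R k <= 1 &
      forall n, \sum_(1 <= k < n) l k ^+ 2 * (2 * k + 1)%:R <= 1].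

(** Since [wgt k * alpha k >= 1], the term [a k] dominates [|lambda k| * wgt k]. As [a k <= 1], this
    also yields [|lambda k| <= alpha k], so [a k] dominates [lambda k ^ 2 * (2k + 1)] too. *)
Lemma spectrum_of_hypotheses lambda :
  (ereal_sup [set `|lambda k|%:E | k in [set k | (1 <= k)%N]] < 1)%E ->
  (\sum_(1 <= k <oo)
     (`|lambda k| * (2 * k + 1)%N%:R * alpha R k)%:E <= 1)%E ->
  exists r, contractive_spectrum (fun k => if k is 0 then 1 else lambda k) r.
Proof.
move=> hsup hsum.
have le_sup k : (0 < k)%N -> (`|lambda k|%:E <=
    ereal_sup [set `|lambda k|%:E | k in [set k | (1 <= k)%N]])%E.
  by move=> k0; apply: ereal_sup_ubound; exists k.
(* The supremum serves as [r]; it is not [-oo], being at least [|lambda 1|]. *)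
move: hsup le_sup; case: (ereal_sup _) => [r| |] //; last first.
  by move=> _ /(_ 1%N isT).
rewrite lte_fin => r1 le_sup; exists r.
have lr k : (0 < k)%N -> `|lambda k| <= r by move=> k0; rewrite -lee_fin le_sup.
pose a k := `|lambda k| * (2 * k + 1)%N%:R * alpha R k.
have a0 k : 0 <= a k by rewrite !mulr_ge0// alpha_ge0.
have suma n : \sum_(1 <= k < n) a k <= 1.
  rewrite -lee_fin -sumEFin; apply: le_trans hsum.
  by apply: nneseries_lim_ge => k _ _; rewrite lee_fin.
have w0 k : 0 < wgt R k by rewrite (lt_le_trans ltr01)// wgt_ge1.
have aw k : 1 <= wgt R k * alpha R k.
  rewrite -(@expr_ge1 _ 2) ?mulr_ge0 ?wgt_ge0 ?alpha_ge0//.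
  by rewrite exprMn expr2 wgt_sqr alpha_sqr_ge.
have ak k : (0 < k)%N -> a k <= 1.
  move=> k0; apply: le_trans (suma k.+1).
  by rewrite big_nat_recr//= lerDr sumr_ge0.
have aE k : a k = (`|lambda k| * wgt R k) * (wgt R k * alpha R k).
  by rewrite /a -wgt_sqr; ring.
have la k : (0 < k)%N -> `|lambda k| <= alpha R k.
  move=> k0; rewrite -(@ler_pM2l _ (wgt R k))//; apply: le_trans (aw k).
  apply: le_trans (ak k k0); rewrite aE mulrC ler_peMr// mulr_ge0//.
  exact: wgt_ge0.
split => //.
- by rewrite r1 andbT; apply: le_trans (lr 1%N isT).
- by case=> // k _; exact: lr.
- move=> n; apply: le_trans (suma n); rewrite !big_nat; apply: ler_sum => -[//|k] _.
  by rewrite aE ler_peMr// mulr_ge0// wgt_ge0.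
- move=> n; apply: le_trans (suma n); rewrite !big_nat; apply: ler_sum => -[//|k] _.
  rewrite /a -[lambda k.+1 ^+ 2]real_normK ?num_real// expr2 mulrAC ler_wpM2l ?mulr_ge0//.
  exact: la.
Qed.

Section Spectrum.
Variables (l : nat -> R) (r : R).
Hypothesis hl : contractive_spectrum l r.

Let norm_l_le1 k : `|l k| <= 1.
Proof.
have [l0 /andP[_ /ltW r1] lr _ _] := hl; case: k => [|k]; first by rewrite l0 normr1.
by rewrite (le_trans (lr _ _)).
Qed.

Let summable_of_tail (c : nat -> R) (B : R) :
  (forall n, \sum_(1 <= k < n) `|c k| * wgt R k <= B) -> legendre_summable c.
Proof.
move=> cB; apply: nondecreasing_is_cvgn.
  by apply: nondecreasing_series => k _ _; rewrite mulr_ge0// wgt_ge0.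
exists (`|c 0%N| * wgt R 0 + B) => _ [n _ <-]; rewrite /series/=.
case: n => [|n]; last by rewrite big_ltn// lerD2l.
rewrite big_geq// addr_ge0 ?mulr_ge0 ?wgt_ge0//.
by have := cB 0%N; rewrite big_geq.
Qed.

Lemma spectrum_summable n b : (0 < n)%N -> (forall k, `|b k| <= 1) ->
  legendre_summable (fun k => l k ^+ n * b k).
Proof.
case: n => // n _ b1; have [_ _ _ hs _] := hl.
apply: (@summable_of_tail _ 1) => m; apply: le_trans (hs m).
apply: ler_sum => k _; rewrite ler_wpM2r ?wgt_ge0// normrM exprS normrM -mulrA.
by rewrite ler_piMr// mulr_ile1// normrX exprn_ile1.
Qed.

(** Here [b] may grow like [wgt], so two of the [n] factors [l k] are spent on the weight
    [wgt k ^ 2]; the other [n - 2] give the geometric rate. *)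
Let tail_le n b (B : R) m : (1 < n)%N -> (forall k, (0 < k)%N -> `|b k| <= wgt R k * B) ->
  \sum_(1 <= k < m) `|l k ^+ n * b k| * wgt R k <= r ^+ (n - 2) * B.
Proof.
case: n => [|[|n]]// _ bB; have [_ /andP[r0 _] lr _ hs] := hl.
have B0 : 0 <= B.
  have := bB 1%N isT; have := wgt_ge1 R 1; have := normr_ge0 (b 1%N).
  by move=> h1 h2 h3; have := le_trans h1 h3; rewrite pmulr_rge0//; lra.
rewrite -addn2 addnK; apply: (@le_trans _ _
    (\sum_(1 <= k < m) (r ^+ n * B) * (l k ^+ 2 * (2 * k + 1)%:R))).
  rewrite !big_nat; apply: ler_sum => k /andP[k0 _].
  rewrite normrM exprD normrM !normrX real_normK ?num_real// -wgt_sqr.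
  apply: (@le_trans _ _ (r ^+ n * l k ^+ 2 * (wgt R k * B) * wgt R k)).
    rewrite ler_wpM2r ?wgt_ge0//; apply: ler_pM => //; last exact: bB.
      by rewrite mulr_ge0 ?sqr_ge0// exprn_ge0.
    by rewrite ler_wpM2r ?sqr_ge0// lerXn2r ?nnegrE// lr.
  by lra.
by rewrite -mulr_sumr ler_piMr ?mulr_ge0 ?exprn_ge0.
Qed.

Lemma spectrum_summable2 n b (B : R) : (1 < n)%N ->
  (forall k, (0 < k)%N -> `|b k| <= wgt R k * B) ->
  legendre_summable (fun k => l k ^+ n * b k).
Proof. by move=> n1 bB; apply: (@summable_of_tail _ (r ^+ (n - 2) * B)) => m; exact: tail_le. Qed.

(** The term [k = 0] is exactly [b 0], and the rest is [tail_le]. It is used for the copula density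
    with [b k = phi k y] and [B = 1], and for the chain with [B] the probability of the starting
    event. *)
Lemma lseries_spectrum_le n b (B t : R) : (1 < n)%N ->
  (forall k, (0 < k)%N -> `|b k| <= wgt R k * B) ->
  `|lseries (fun k => l k ^+ n * b k) t - b 0%N| <= r ^+ (n - 2) * B.
Proof.
move=> n1 bB; have cc := spectrum_summable2 n1 bB.
have l0 : l 0%N = 1 by case: hl.
have h : `|series (fun k => (l k ^+ n * b k) * phi k t) m - b 0%N| @[m --> \oo] -->
    `|lseries (fun k => l k ^+ n * b k) t - b 0%N|.
  by apply: cvg_norm; apply: cvgB; [exact: cvg_lseries|exact: cvg_cst].
rewrite -(cvg_lim _ h)//; apply: limr_le; first by apply/cvg_ex; eexists; exact: h.
near=> m; have m0 : (0 < m)%N by near: m; exact: nbhs_infty_gt.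
rewrite /series/= big_ltn// phi0 l0 expr1n mul1r mulr1 addrAC subrr add0r.
apply: le_trans (ler_norm_sum _ _ _) _; apply: le_trans (tail_le m n1 bB).
by apply: ler_sum => k _; rewrite normrM ler_wpM2l// phi_le.
Unshelve. all: by end_near. Qed.

End Spectrum.

(** * Expansion and densities of the copula powers *)

Section CopulaPowers.
Variables (lambda : nat -> R) (C : R -> R -> R) (r : R).
Let l := fun k => if k is 0%N then 1 else lambda k.
Hypothesis hl : contractive_spectrum l r.
Hypothesis hC : legendre_copula lambda C.

Lemma copula_series u v : 0 <= u <= 1 -> 0 <= v <= 1 ->
  series (fun k => l k * (Phi k u * Phi k v)) @ \oo --> C u v.
Proof.
move=> u01 v01; have := @hC u v; rewrite !in_itv/= => /(_ u01 v01).
apply: cvg_trans; apply: near_eq_cvg; near=> n.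
have n0 : (0 < n)%N by near: n; exact: nbhs_infty_gt.
rewrite /series/= [RHS]big_ltn//= !Phi0// mul1r; congr (_ + _).
by rewrite !big_nat; apply: eq_bigr => -[//|k] _; rewrite -mulrA.
Unshelve. all: by end_near. Qed.

(** By induction: the two partial derivatives in the product are Legendre series in the integration
    variable, and Parseval's identity multiplies [l k ^ n.+1] by [l k]. *)
Lemma copula_pow_series n u v : 0 <= u <= 1 -> 0 <= v <= 1 ->
  series (fun k => l k ^+ n.+1 * (Phi k u * Phi k v)) @ \oo -->
    copula_pow C n.+1 u v.
Proof.
elim: n u v => [|n IH] u v u01 v01; first exact: copula_series.
pose c k := l k ^+ n.+1 * Phi k u; pose c' k := l k ^+ 1 * Phi k v.
have cc : legendre_summable c.
  by apply: (spectrum_summable hl) => // k; exact: normr_Phi_le1.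
have cc' : legendre_summable c'.
  by apply: (spectrum_summable hl) => // k; exact: normr_Phi_le1.
have -> : copula_pow C n.+2 u v = \int[mu]_(x in `[0, 1]) (lseries c x * lseries c' x).
  pose f x := lseries c x * lseries c' x.
  pose g t := D2 (copula_pow C n.+1) u t * D1 C t v.
  have mf : measurable_fun (`]0, 1[%classic : set (measurableTypeR R)) f.
    by apply: measurable_funTS; apply: measurable_funM; exact: measurable_lseries.
  (* At [0] and [1] the two-sided derivatives may see values outside the square; agreement on the
     open interval is enough for the integral. *)
  have gf : {in `]0, 1[, g =1 f}.
    move=> t; rewrite in_itv/= => t01; congr (_ * _).
      rewrite /D2 (lseries_derive cc t01)// => w w01.
      by under eq_fun do rewrite -mulrA; exact: IH.
    rewrite /D1 (lseries_derive cc' t01)// => w w01.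
    under eq_fun do rewrite -mulrA expr1 [Phi _ _ * _]mulrC.
    exact: copula_series.
  have mg : measurable_fun (`]0, 1[%classic : set (measurableTypeR R)) g.
    by apply: (eq_measurable_fun _ _ mf) => t tt; rewrite gf// -inE.
  transitivity (fine (\int[mu]_(x in `[0, 1]) (g x)%:E)) => //; congr fine.
  exact: eq_integral_itv_bounded.
have := integral_lseriesM cc cc'.
rewrite (_ : (fun k => c k * c' k) = (fun k => l k ^+ n.+2 * (Phi k u * Phi k v)))//.
by apply/funext => k; rewrite /c /c' expr1 [in RHS]exprSr; ring.
Qed.

Definition legendre_density n (z : measurableTypeR R * measurableTypeR R) : R :=
  lseries (fun k => l k ^+ n * phi k z.2) z.1.

Let density_bound n z : (1 < n)%N -> `|legendre_density n z - 1| <= r ^+ (n - 2).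
Proof.
move=> n1; have := @lseries_spectrum_le l r hl n (fun k => phi k z.2) 1 z.1 n1 _.
by rewrite mulr1 phi0; apply => k _; rewrite mulr1; exact: phi_le.
Qed.

Let measurable_phi12 n k : measurable_fun [set: measurableTypeR R * measurableTypeR R]
  (fun z => l k ^+ n * phi k z.2 * phi k z.1).
Proof.
apply: measurable_funM; first apply: measurable_funM; first exact: measurable_cst.
  by apply: measurableT_comp => //; exact: measurable_phi.
by apply: measurableT_comp => //; exact: measurable_phi.
Qed.

Lemma Rintegral_prod (A B : set (measurableTypeR R)) (f g : R -> R) (M : R) :
  measurable A -> measurable B -> (mu A < +oo)%E -> (mu B < +oo)%E ->
  measurable_fun [set: R] f -> measurable_fun [set: R] g ->
  (forall x, `|f x| <= M) -> (forall x, `|g x| <= M) ->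
  \int[lebesgue2 R]_(z in A `*` B) (g z.2 * f z.1) =
  (\int[mu]_(x in A) f x) * (\int[mu]_(x in B) g x).
Proof.
move=> mA mB Aoo Boo mf mg fM gM.
have iA : mu.-integrable A (EFin \o f).
  by apply: (bounded_integrable (M := M)) => //; exact: measurable_funTS.
have iB : mu.-integrable B (EFin \o g).
  by apply: (bounded_integrable (M := M)) => //; exact: measurable_funTS.
have mfg : measurable_fun [set: measurableTypeR R * measurableTypeR R]
    (fun z => g z.2 * f z.1).
  by apply: measurable_funM; exact: measurableT_comp.
have iAB : (lebesgue2 R).-integrable (A `*` B) (EFin \o (fun z => g z.2 * f z.1)).
  apply: (bounded_integrable (M := M * M)).
  - exact: measurableX.
  - rewrite [ltLHS](_ : _ = mu A * mu B)%E; last exact: product_measure1E.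
    by rewrite lte_mul_pinfty// ge0_fin_numE.
  - exact: measurable_funTS.
  - by move=> z _; rewrite normrM ler_pM.
have iT := (integrable_mkcond _ (measurableX mA mB)).1 iAB.
have inner x : fubini_F mu ((EFin \o (fun z => g z.2 * f z.1)) \_ (A `*` B)) x =
    ((EFin \o (fun x => (\int[mu]_(y in B) g y * f x)%R)) \_ A) x.
  rewrite /fubini_F [in RHS]patchE; case: ifPn => xA.
    rewrite /= -RintegralZr// /Rintegral fineK; last first.
      exact: integrable_fin_num (integrableZr mB _ iB).
    rewrite [RHS]integral_mkcond; apply: eq_integral => y _; rewrite !patchE.
    by rewrite in_setX /= xA.
  apply: integral0_eq => y _; rewrite patchE in_setX /=.
  by rewrite (negbTE xA).
have h := integral12_prod_meas1 (m1 := mu) (m2 := mu) iT.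
rewrite {1}/Rintegral integral_mkcond [X in fine X](_ : _ = (\int[mu]_x
  ((EFin \o (fun x => (\int[mu]_(y in B) g y * f x)%R)) \_ A) x)%E).
  rewrite -integral_mkcond -/(Rintegral mu A _) RintegralZl//.
  by rewrite mulrC.
by rewrite -h; apply: eq_integral => x _; rewrite inner.
Qed.

(** Nonnegativity holds because the density is within [r ^ (n - 2) <= 1] of [1]. The distribution
    function comes from integrating the series over a rectangle term by term, each term splitting by
    Fubini. *)
Lemma copula_pow_density n : (1 < n)%N -> is_density (legendre_density n) (copula_pow C n).
Proof.
move=> n1.
have [_ /andP[r0 /ltW r1] _ _ _] := hl.
have cc z : legendre_summable (fun k => l k ^+ n * phi k z).
  by apply: (@spectrum_summable2 l r hl n _ 1) => // k _; rewrite mulr1 phi_le.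
split.
- apply: measurable_funTS.
  apply: (measurable_fun_cvg (h := fun m z => series (fun k => l k ^+ n * phi k z.2 * phi k z.1) m)).
    by move=> m; apply: measurable_sum => k; exact: measurable_phi12.
  by move=> z _; exact: cvg_lseries.
- move=> z _; have := density_bound z n1; have : r ^+ (n - 2) <= 1 by rewrite exprn_ile1.
  by rewrite ler_norml => h1 /andP[h2 _]; lra.
move=> u v; rewrite !in_itv/= => u01 v01.
have itv_fin w : (mu `[0%R, w] < +oo)%E.
  by rewrite [ltLHS]lebesgue_measure_itv/=; case: ifP => _; rewrite ?ltry// -EFinD ltry.
have mD : measurable (`[0, u] `*` `[0, v] : set (measurableTypeR R * measurableTypeR R)).
  exact: measurableX.
have Doo : (lebesgue2 R (`[0%R, u] `*` `[0%R, v]) < +oo)%E.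
  rewrite [ltLHS](_ : _ = mu `[0%R, u] * mu `[0%R, v])%E; last exact: product_measure1E.
  by rewrite lte_mul_pinfty// ge0_fin_numE.
have [] := @integral_series R _ _ (lebesgue2 R) (`[0, u] `*` `[0, v])
  (fun k z => l k ^+ n * phi k z.2 * phi k z.1)
  (fun k => `|l k ^+ n * wgt R k| * wgt R k) mD Doo.
- by move=> k; exact: measurable_funTS.
- move=> k z _; rewrite [leLHS]normrM; apply: ler_pM; rewrite ?phi_le//.
  rewrite normrM [leRHS]normrM; apply: ler_wpM2l; first exact: normr_ge0.
  exact: le_trans (phi_le _ _) (ler_norm _).
- apply: (@spectrum_summable2 l r hl n _ 1) => // k _.
  by rewrite mulr1 ger0_norm// wgt_ge0.
move=> _ ic hc.
suff -> : copula_pow C n u v =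
    \int[lebesgue2 R]_(z in `[0, u] `*` `[0, v]) legendre_density n z.
  by rewrite /Rintegral fineK//; exact: (integrable_fin_num mD ic).
rewrite -(cvg_lim _ hc)//; apply/esym/cvg_lim => //.
rewrite (_ : (fun k => _) = (fun k => l k ^+ n * (Phi k u * Phi k v))).
  by case: n n1 {cc ic hc} => // n _; exact: copula_pow_series.
apply/funext => k.
transitivity (l k ^+ n * \int[lebesgue2 R]_(z in `[0, u] `*` `[0, v])
    (phi k z.2 * phi k z.1)).
  rewrite -RintegralZl//; first by apply: eq_Rintegral => z _; rewrite mulrA.
  apply: (bounded_integrable (M := wgt R k * wgt R k)) => //.
    apply: measurable_funTS; apply: measurable_funM.
      by apply: measurableT_comp => //; exact: measurable_phi.
    by apply: measurableT_comp => //; exact: measurable_phi.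
  by move=> z _; rewrite normrM ler_pM// phi_le.
congr (_ * _); rewrite (@Rintegral_prod _ _ _ _ (wgt R k)) ?PhiE//.
- exact: measurable_phi.
- exact: measurable_phi.
- by move=> x; exact: phi_le.
- by move=> x; exact: phi_le.
Qed.

Lemma copula_pow_density_le : exists N, forall n, (N <= n)%N ->
  is_density (legendre_density n) (copula_pow C n) /\
  forall z, legendre_density n z <= 3 / 2.
Proof.
have [_ /andP[r0 r1] _ _ _] := hl.
have r1' : `|r| < 1 by rewrite ger0_norm.
have i2 : 0 < 2^-1 :> R by rewrite invr_gt0.
(* Once [r ^ (n - 2) <= 1/2] the density is at most [3/2]; the shift by two accounts for [N.+2]. *)
have [N _ hN] := (cvgrPdist_le _ _).1 (cvg_expr r1') _ i2. exists N.+2 => n Nn; split; first by apply: copula_pow_density; lia.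
move=> z; have h := hN (n - 2)%N; have := @density_bound n z.
rewrite ler_norml => /(_ _)/andP[|_]; first by lia.
have := h _; rewrite /= sub0r normrN ger0_norm ?exprn_ge0// => h1 h2.
by have {}h1 := h1 _; have : r ^+ (n - 2) <= 2^-1 by [apply: h1; lia]; lra.
Qed.

End CopulaPowers.
End LegendreCopula.

(** * Densities of measures and comparison of integrals *)

Section MeasureTransfer.
Variable R : realType.

(** The measure [nu] is absolutely continuous, and its Radon-Nikodym derivative agrees almost
    everywhere with [h] extended by zero outside [I]. *)
Lemma integral_density d (T : measurableType d)
    (nu : {finite_measure set T -> \bar R})
    (mu : {sigma_finite_measure set T -> \bar R}) (I : set T) (h f : T -> R)
    (M M' : R) (D : set T) :
  measurable I -> (mu I < +oo)%E ->
  measurable_fun [set: T] h -> (forall x, `|h x| <= M) ->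
  measurable_fun [set: T] f -> (forall x, `|f x| <= M') ->
  (forall B, measurable B -> nu B = (\int[mu]_(x in B `&` I) (h x)%:E)%E) ->
  measurable D ->
  (\int[nu]_(x in D) (f x)%:E = \int[mu]_(x in D `&` I) (f x * h x)%:E)%E.
Proof.
move=> mI Ioo mh hM mf fM nuE mD.
have dom : nu `<< mu.
  apply/null_content_dominatesP => A mA A0; rewrite nuE//.
  apply: null_set_integral; first exact: measurableI.
    by apply/measurable_EFinP; exact: measurable_funTS.
  apply/eqP; rewrite -measure_le0 -A0.
  by apply: le_measure; rewrite ?inE//; exact: measurableI.
have ih : mu.-integrable I (EFin \o h).
  by apply: (bounded_integrable (M := M)) => //; exact: measurable_funTS.
have ihT := (integrable_mkcond (EFin \o h) mI).1 ih.
have ae : ae_eq mu setT (Radon_Nikodym (charge_of_finite_measure nu) mu) ((EFin \o h) \_ I).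
  apply: integral_ae_eq => //.
  - exact: Radon_Nikodym_integrable.
  - exact: measurable_int ihT.
  - by move=> A _ mA; rewrite -Radon_Nikodym_integral// -integral_mkcondr -nuE.
have inf : nu.-integrable D (EFin \o f).
  apply: (bounded_integrable (M := M')) => //; last exact: measurable_funTS.
  by rewrite ltey_eq fin_num_measure.
rewrite -(Radon_Nikodym_change_of_variables dom mD inf).
have mRN : measurable_fun D (Radon_Nikodym (charge_of_finite_measure nu) mu).
  apply: measurable_funTS.
  by have /integrableP[] := Radon_Nikodym_integrable (nu := charge_of_finite_measure nu) dom.
have mhI : measurable_fun D ((EFin \o h) \_ I).
  by apply: measurable_funTS; exact: measurable_int ihT.
have mfD : measurable_fun D (EFin \o f).
  by apply/measurable_EFinP; exact: measurable_funTS.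
transitivity (\int[mu]_(x in D) ((f x)%:E * ((EFin \o h) \_ I) x))%E.
  apply: ae_eq_integral => //.
  - exact: emeasurable_funM.
  - exact: emeasurable_funM.
  - by apply: ae_eqe_mul2l; apply: ae_eq_subset ae.
rewrite integral_mkcondr; apply: eq_integral => x _; rewrite !patchE.
by case: ifPn => // _; rewrite mule0.
Qed.

(** As [h] may change sign, its integral is not known to be a measure, so uniqueness of measures is
    replaced by a Dynkin argument on the identity itself. Stability under complement subtracts from
    the finite total mass. *)
Lemma density_of_cdf (nu : {finite_measure set (measurableTypeR R) -> \bar R})
    (h : R -> R) (M : R) (B : set R) :
  measurable_fun [set: R] h -> (forall x, `|h x| <= M) ->
  nu (~` `[0%R, 1%R]) = 0%E ->
  (forall v, 0 <= v <= 1 ->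
     nu `]-oo, v]%classic = (\int[lebesgue_measure]_(x in `[0%R, v]) (h x)%:E)%E) ->
  measurable B ->
  nu B = (\int[lebesgue_measure]_(x in B `&` `[0%R, 1%R]) (h x)%:E)%E.
Proof.
move=> mh hM nu0 nuE mB.
pose I : set (measurableTypeR R) := `[0, 1]%classic.
have mI : measurable I by exact: measurable_itv.
have ih A : measurable A -> lebesgue_measure.-integrable (A `&` I) (EFin \o h).
  move=> mA; apply: (integrableS mI) => //; first exact: measurableI.
  apply: (bounded_integrable (M := M)) => //; last exact: measurable_funTS.
  by rewrite [ltLHS](_ : _ = 1%E) ?ltry//; exact: lebesgue_unit.
have nuI A : measurable A -> nu A = nu (A `&` I).
  move=> mA; rewrite (measureDI nu mA mI) [X in (X + _)%E](_ : _ = 0%E) ?add0e//.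
  apply/eqP; rewrite -measure_le0 -nu0; apply: le_measure; rewrite ?inE//.
  - exact: measurableD.
  - exact: measurableC.
have nuT : nu setT = (\int[lebesgue_measure]_(x in I) (h x)%:E)%E.
  rewrite nuI// setTI -(nuE 1) ?ler01 ?lexx// [RHS]nuI//; congr (nu _).
  by apply/esym/setIidr => x /=; rewrite !in_itv/= => /andP[].
pose Q (S : set (measurableTypeR R)) :=
  nu S = (\int[lebesgue_measure]_(x in S `&` I) (h x)%:E)%E.
have QC S : measurable S -> Q S -> Q (~` S).
  move=> mS QS.
  have e1 : nu setT = (nu (~` S) + nu S)%E.
    by rewrite (measureDI nu measurableT mS) setTD setTI.
  have e2 : (\int[lebesgue_measure]_(x in I) (h x)%:E =
      \int[lebesgue_measure]_(x in ~` S `&` I) (h x)%:E +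
      \int[lebesgue_measure]_(x in S `&` I) (h x)%:E)%E.
    rewrite -integral_setU//; last 4 first.
    - by apply: measurableI => //; exact: measurableC.
    - exact: measurableI.
    - by apply/measurable_EFinP; exact: measurable_funTS.
    - by apply/disj_setPS => x [[nS _] [xS _]]; exact: nS.
    by rewrite -setIUl setvU setTI.
  have fS : nu S \is a fin_num by exact: fin_num_measure.
  by rewrite /Q -[LHS](@addeK _ (nu S))// -e1 nuT e2 QS addeK// -QS.
have LP x y : `]-oo, x]%classic y <-> y <= x by rewrite /= in_itv.
have IP y : I y <-> 0 <= y <= 1 by rewrite /I /= in_itv.
have Qle x : Q `]-oo, x]%classic.
  rewrite /Q; have [x0|x0] := ltP x 0.
    rewrite [X in integral _ X](_ : _ = set0); last first.
      apply/seteqP; split => // y [/LP yx /IP/andP[y0 _]].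
      by have := lt_le_trans x0 y0; rewrite ltNge yx.
    rewrite integral_set0; apply/eqP; rewrite -measure_le0 -nu0.
    apply: le_measure; rewrite ?inE//; first exact: measurableC.
    move=> y /LP yx /IP/andP[y0 _].
    by have := lt_le_trans x0 y0; rewrite ltNge yx.
  have [x1|x1] := leP x 1.
    rewrite nuE ?x0//; congr integral; apply/seteqP; split => y.
      rewrite [X in X -> _]/= in_itv/= => /andP[y0 yx].
      by split; [exact/LP|apply/IP; rewrite y0 (le_trans yx)].
    by move=> [/LP yx /IP/andP[y0 _]]; rewrite /= in_itv/= y0.
  have xI z : 1 <= z -> `]-oo, z]%classic `&` I = I.
    by move=> z1; apply/setIidr => y /IP/andP[_ y1]; apply/LP; exact: le_trans z1.
  by rewrite xI ?ltW// -nuT nuI// xI ?ltW// [RHS]nuI// setTI.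
have e : @measurable _ (measurableTypeR R) = <<s @RGenOInfty.G R >>.
  exact: RGenOInfty.measurableE.
suff : forall S, <<s @RGenOInfty.G R >> S -> Q S.
  by apply; rewrite -e.
(* The generators are the open right rays, stable under intersection; each is the complement of a
   left ray, where [Qle] applies. *)
apply: dynkin_induction.
- exact: RGenOInfty.measurableE.
- move=> _ _ [x ->] [y ->]; exists (Num.max x y).
  by apply/seteqP; split => z /=; rewrite !in_itv/= !andbT gt_max => /andP.
- by rewrite /Q setTI.
- by move=> _ [x ->]; rewrite -setCitvl; apply: QC => //; exact: Qle.
- exact: QC.
- move=> F mF tF QF; rewrite /Q measure_semi_bigcup//; last first.
    by apply: bigcup_measurable => k _; exact: mF.
  rewrite setI_bigcupl.
  rewrite integral_bigcup.
  + by apply: eq_eseriesr => i _; exact: QF.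
  + exact: trivIset_setIr.
  + by move=> k; apply: measurableI => //; exact: mF.
  + by rewrite -setI_bigcupl; apply: ih; apply: bigcup_measurable => k _; exact: mF.
Qed.

(** Splitting along the sign of [Y - Z], the two test sets already force [|Y - Z|] to have integral
    zero. This carries an identity from the events of [U n] to every past event. *)
Lemma Rintegral_eq_of_cond d (T : measurableType d) (m : {measure set T -> \bar R})
    (Y Z : T -> R) (F : set T) :
  m.-integrable [set: T] (EFin \o Y) -> m.-integrable [set: T] (EFin \o Z) ->
  measurable F -> measurable [set w | Z w < Y w] ->
  (forall G, G = [set w | Z w < Y w] \/ G = ~` [set w | Z w < Y w] ->
    \int[m]_(w in G) Y w = \int[m]_(w in G) Z w) ->
  \int[m]_(w in F) Y w = \int[m]_(w in F) Z w.
Proof.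
move=> iY iZ mF mG h; set G := [set w | _] in mG h.
have iYS S : measurable S -> m.-integrable S (EFin \o Y) by move=> mS; exact: integrableS iY.
have iZS S : measurable S -> m.-integrable S (EFin \o Z) by move=> mS; exact: integrableS iZ.
have iD S : measurable S -> m.-integrable S (EFin \o (fun w => Y w - Z w)).
  by move=> mS; exact: (integrableB mS (iYS _ mS) (iZS _ mS)).
have iN S : measurable S -> m.-integrable S (EFin \o (fun w => `|Y w - Z w|)).
  by move=> mS; exact: integrable_norm (iD _ mS).
have mGC : measurable (~` G) by exact: measurableC.
have zero : \int[m]_(w in [set: T]) `|Y w - Z w| = 0.
  rewrite -(setvU G) Rintegral_setU//; last 2 first.
  - by rewrite setvU; exact: iN.
  - by apply/disj_setPS => x [].
  rewrite (@eq_Rintegral _ _ _ _ G (fun w => Y w - Z w)); last first.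
    by move=> w; rewrite inE => /= wG; rewrite ger0_norm// subr_ge0 ltW.
  rewrite (@eq_Rintegral _ _ _ _ (~` G) (fun w => Z w - Y w)); last first.
    move=> w; rewrite inE => /= /negP; rewrite -leNgt => wG.
    by rewrite ler0_norm ?opprB// subr_le0.
  rewrite !RintegralB//; [|exact: iYS|exact: iZS|exact: iZS|exact: iYS].
  by rewrite !h ?subrr ?addr0//; [left|right].
apply/eqP; rewrite -subr_eq0 -RintegralB//; [|exact: iYS|exact: iZS].
rewrite -normr_le0; apply: le_trans (le_normr_Rintegral mF (iD _ mF)) _.
rewrite -zero; apply: fine_le.
- exact: integrable_fin_num (iN _ mF).
- exact: integrable_fin_num (iN _ measurableT).
- apply: ge0_subset_integral => //.
  by have /integrableP[] := iN _ measurableT.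
Qed.

End MeasureTransfer.

(** * The law of a random variable on an event *)

Section JointLaw.
Context d (T : measurableType d) (R : realType) (P : probability T R).
Variables (E : set T) (mE : measurable E) (X : {RV P >-> R}).
Local Notation mu := (@lebesgue_measure R).

Let mX B : measurable B -> measurable (X @^-1` B).
Proof. by move=> mB; exact: measurable_funPTI. Qed.

(** Left unnormalised, so an event [E] of probability zero needs no separate treatment. *)
Definition joint_law (B : set (measurableTypeR R)) : \bar R :=
  P (E `&` X @^-1` B).

Let joint_law0 : joint_law set0 = 0%E.
Proof. by rewrite /joint_law preimage_set0 setI0 measure0. Qed.

Let joint_law_ge0 A : (0 <= joint_law A)%E.
Proof. exact: measure_ge0. Qed.

Let joint_law_sigma_additive : semi_sigma_additive joint_law.
Proof.
move=> F mF tF mUF; rewrite /joint_law preimage_bigcup setI_bigcupr.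
apply: measure_semi_sigma_additive.
- by move=> n; apply: measurableI => //; apply: mX; exact: mF.
- apply/trivIsetP => i j _ _ ij; rewrite setIACA -[X in _ `&` X]preimage_setI.
  by move/trivIsetP : tF => ->//; rewrite preimage_set0 setI0.
- rewrite -setI_bigcupr -preimage_bigcup; apply: measurableI => //.
  exact: mX.
Qed.

HB.instance Definition _ := isMeasure.Build _ _ _ joint_law
  joint_law0 joint_law_ge0 joint_law_sigma_additive.

Let joint_law_fin : fin_num_fun joint_law.
Proof.
move=> A mA; rewrite /joint_law fin_num_measure//.
by apply: measurableI => //; exact: mX.
Qed.

HB.instance Definition _ := Measure_isFinite.Build _ _ _ joint_law joint_law_fin.

(** [joint_law] is the image under [X] of [P] restricted to [E]; it remains to change variables and
    insert the density [h]. *)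
Lemma Rintegral_joint_law (h f : R -> R) (M M' : R) (B : set R) :
  measurable_fun [set: R] h -> (forall x, `|h x| <= M) ->
  measurable_fun [set: R] f -> (forall x, `|f x| <= M') ->
  (forall B, measurable B -> P (E `&` X @^-1` B) =
    (\int[mu]_(x in B `&` `[0%R, 1%R]) (h x)%:E)%E) ->
  measurable B ->
  \int[P]_(w in E `&` X @^-1` B) f (X w) =
  \int[mu]_(x in B `&` `[0, 1]) (f x * h x).
Proof.
move=> mh hM mf fM hE mB; rewrite /Rintegral; congr fine.
have mfX : measurable_fun [set: T] (f \o X) by exact: measurableT_comp.
transitivity (\int[joint_law]_(x in B) (f x)%:E)%E; last first.
  apply: (integral_density (M := M) (M' := M')) => //.
    by rewrite [ltLHS](_ : _ = 1%E) ?ltry//; exact: lebesgue_unit.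
have Eoo : (P E < +oo)%E by rewrite ltey_eq fin_num_measure.
transitivity (\int[mfrestr mE Eoo]_(w in X @^-1` B) (f (X w))%:E)%E; last first.
  have mX2 : measurable_fun [set: T] (X : T -> measurableTypeR R).
    by move=> _ A mA; rewrite setTI; exact: mX.
  have mf2 : measurable_fun [set: measurableTypeR R] (EFin \o f).
    exact/measurable_EFinP.
  have ifX : (mfrestr mE Eoo).-integrable (X @^-1` B) ((EFin \o f) \o X).
    apply: (bounded_integrable (g := f \o X) (M := M')) => //; first exact: mX.
      by rewrite ltey_eq fin_num_measure//; exact: mX.
      exact: measurable_funTS.
    by move=> w _; exact: fM.
  rewrite -[LHS](integral_pushforward mX2 mf2 ifX mB).
  apply: eq_measure_integral => A mA _.
  by transitivity (P (X @^-1` A `&` E)); [by []|rewrite setIC].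
(* The restriction of [P] to [E] is itself a measure with density [1] on [E] with respect to [P]. *)
rewrite (@integral_density _ _ _ (mfrestr mE Eoo) P E (fun=> 1) (f \o X) 1 M').
- by rewrite setIC; apply: eq_integral => w _; rewrite /= mulr1.
- exact: mE.
- exact: Eoo.
- exact: measurable_cst.
- by move=> w; rewrite normr1.
- exact: mfX.
- by move=> w; exact: fM.
- move=> A mA; rewrite /mfrestr /mrestr integral_cst ?mul1e//.
  exact: measurableI.
- exact: mX.
Qed.

Lemma joint_law_density (h : R -> R) (M : R) (B : set R) :
  measurable_fun [set: R] h -> (forall x, `|h x| <= M) ->
  (forall A, measurable A -> P (X @^-1` A) = mu (A `&` `[0%R, 1%R])) ->
  (forall v, 0 <= v <= 1 -> P (E `&` X @^-1` `]-oo, v]) =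
    (\int[mu]_(x in `[0%R, v]) (h x)%:E)%E) ->
  measurable B ->
  P (E `&` X @^-1` B) = (\int[mu]_(x in B `&` `[0%R, 1%R]) (h x)%:E)%E.
Proof.
move=> mh hM law hE mB.
rewrite -(@density_of_cdf R joint_law h M B)//.
have mI : measurable (~` (`[0%R, 1%R] : set (measurableTypeR R))).
  by apply: measurableC; exact: measurable_itv.
apply/eqP; rewrite -measure_le0 /joint_law.
apply: (@le_trans _ _ (P (X @^-1` (~` `[0%R, 1%R])))).
  apply: le_measure; rewrite ?inE//; last exact: mX.
  by apply: measurableI => //; exact: mX.
by rewrite law// setICl measure0.
Qed.

End JointLaw.

(** * The Markov chain: marginals and transition kernel *)

Section ChainLaw.
Context d (T : measurableType d) (R : realType) (P : probability T R).
Variables (U : nat -> {RV P >-> R}) (C : R -> R -> R).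
Hypothesis hU : chain_generated_by C U.
Local Notation mu := (@lebesgue_measure R).

Lemma chain_uniform n A : measurable A ->
  P (U n @^-1` A) = mu (A `&` `[0%R, 1%R]).
Proof.
move=> mA; case: hU => _ /(_ n A mA) + _; rewrite /distribution /pushforward => ->.
rewrite /uniform_prob integral_uniform_pdf.
rewrite (eq_integral (cst 1%E)); last first.
  move=> x; rewrite inE => -[_ /=]; rewrite in_itv/= => x01.
  by rewrite /uniform_pdf x01 subr0 invr1.
by rewrite integral_cst ?mul1e//; apply: measurableI.
Qed.

End ChainLaw.

Section ChainStep.
Context d (T : measurableType d) (R : realType) (P : probability T R).
Variables (U : nat -> {RV P >-> R}) (lambda : nat -> R) (C : R -> R -> R) (r : R).
Let l := fun k => if k is 0%N then 1 else lambda k.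
Hypothesis hl : contractive_spectrum l r.
Hypothesis hC : legendre_copula lambda C.
Hypothesis hU : chain_generated_by C U.
Local Notation mu := (@lebesgue_measure R).

Let mU n B : measurable B -> measurable (U n @^-1` B).
Proof. by move=> mB; exact: measurable_funPTI. Qed.

Let Poo A : measurable A -> (P A < +oo)%E.
Proof. by move=> mA; rewrite ltey_eq fin_num_measure. Qed.

Let le_ray v : measurable (`]-oo, v]%classic : set (measurableTypeR R)).
Proof. exact: measurable_itv. Qed.

Lemma chain_expectation n (f : R -> R) (M : R) B :
  measurable_fun [set: R] f -> (forall x, `|f x| <= M) -> measurable B ->
  \int[P]_(w in U n @^-1` B) f (U n w) = \int[mu]_(x in B `&` `[0, 1]) f x.
Proof.
move=> mf fM mB; rewrite [LHS](_ : _ =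
  \int[P]_(w in [set: T] `&` U n @^-1` B) f (U n w)); last by rewrite setTI.
have -> : \int[mu]_(x in B `&` `[0, 1]) f x = \int[mu]_(x in B `&` `[0, 1]) (f x * 1).
  by apply: eq_Rintegral => x _; rewrite mulr1.
apply: (@Rintegral_joint_law _ _ _ P setT measurableT (U n) (fun=> 1) f 1 M) => //.
- by move=> x; rewrite normr1.
- move=> A mA; rewrite setTI (chain_uniform hU)// integral_cst ?mul1e//.
  exact: measurableI.
Qed.

(* A version of P(U_(n+1) <= v | U_n = t), i.e. C_{,1}(t, v). *)
Let ker v := lseries (fun k => l k ^+ 1 * Phi k v).

Let ker_summable v : 0 <= v <= 1 -> legendre_summable (fun k => l k ^+ 1 * Phi k v).
Proof. by move=> v01; apply: (spectrum_summable hl) => // k; exact: normr_Phi_le1. Qed.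

Let ker_bound v := limn (series (fun k => `|l k ^+ 1 * Phi k v| * wgt R k)).

Let ker_int u v : 0 <= u <= 1 -> 0 <= v <= 1 -> C u v = \int[mu]_(x in `[0, u]) ker v x.
Proof.
move=> u01 v01; rewrite -(cvg_lim _ (integral_lseries_itv (ker_summable v01) u01))//.
apply/esym/cvg_lim => //.
under eq_fun do rewrite expr1 -mulrA [Phi _ v * _]mulrC.
exact: (copula_series hC).
Qed.

(** Viewed over the sigma-algebra of [U n], both sides of the inequality are measurable, so the
    event depends on [U n] alone. *)
Lemma measurable_gt_preimage n (Y : T -> R) (Z : R -> R) :
  preimage_set_system [set: T] Y measurable `<=` sigma_rv (U n) ->
  measurable_fun [set: R] Z ->
  exists2 B, measurable B & [set w | Z (U n w) < Y w] = U n @^-1` B.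
Proof.
move=> hY mZ.
pose T1 := g_sigma_algebra_preimageType (U n : T -> R).
have mY : measurable_fun [set: T1] (Y : T1 -> R).
  by move=> _ A mA; apply: hY; exists A.
have mZU : measurable_fun [set: T1] (Z \o U n : T1 -> R).
  move=> _ A mA; exists (Z @^-1` A); last by rewrite comp_preimage.
  by rewrite -[X in measurable X]setTI; exact: mZ.
have : measurable ([set: T1] `&` [set w | ((Z (U n w))%:E < (Y w)%:E)%E]).
  by apply: measurable_lte => //; apply/measurable_EFinP.
move=> [B mB hB]; exists B => //; move: hB; rewrite !setTI => ->.
by apply/seteqP; split => w /=; rewrite lte_fin.
Qed.

(** The Markov property gives one [Y] serving both conditionings. On events of [U n] the law of
    consecutive variables equates its integrals with those of [ker v (U n)]; hence the two agree
    almost surely, and the identity holds on the past event [F]. *)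
Lemma chain_step n v F : 0 <= v <= 1 -> sigma_past U n F -> measurable F ->
  P (F `&` U n.+1 @^-1` `]-oo, v]) = (\int[P]_(w in F) ker v (U n w))%:E.
Proof.
move=> v01 pF mF; have [mk _ hC2] := hU.
have [Y [[_ iY hY] [sY _ hY']]] := mk n `]-oo, v]%classic (le_ray v).
have cc := ker_summable v01.
have mker := measurable_lseries cc.
have ker_le x : `|ker v x| <= ker_bound v by exact: lseries_le.
have iZ : P.-integrable [set: T] (EFin \o (fun w => ker v (U n w))).
  apply: (bounded_integrable (M := ker_bound v)) => //; first exact: Poo.
  exact: measurableT_comp.
have mE : measurable (U n.+1 @^-1` `]-oo, v]%classic) by exact: mU.
have ray w : 0 <= w <= 1 -> P (U n.+1 @^-1` `]-oo, v] `&` U n @^-1` `]-oo, w]) =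
    (\int[mu]_(x in `[0%R, w]) (ker v x)%:E)%E.
  move=> w01; rewrite setIC hC2 ?in_itv//= (ker_int w01 v01) /Rintegral fineK//.
  apply: integrable_fin_num => //.
  apply: continuous_compact_integrable; first exact: segment_compact.
  by apply: continuous_subspaceT => x; exact: continuous_lseries.
have key B : measurable B ->
    \int[P]_(w in U n @^-1` B) Y w = \int[P]_(w in U n @^-1` B) ker v (U n w).
  move=> mB; rewrite (chain_expectation _ mker ker_le mB).
  rewrite /Rintegral hY'; last by exists B; rewrite ?setTI.
  rewrite setIC (joint_law_density mE mker ker_le _ ray)// => A mA.
  exact: (chain_uniform hU).
have [B mB hB] := measurable_gt_preimage sY mker.
rewrite -hY//; rewrite -(@Rintegral_eq_of_cond _ _ _ P Y (fun w => ker v (U n w)) F)//.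
- by rewrite /Rintegral fineK//; apply: integrable_fin_num => //; exact: integrableS iY.
- by rewrite hB; exact: mU.
- move=> G [->|->]; rewrite hB; first exact: key.
  by rewrite preimage_setC; apply: key; exact: measurableC.
Qed.

(** * The law of the chain on a starting event *)

Section JointWithStart.
Variables (A : set R) (mA : measurable A).
Let E := U 0%N @^-1` A.
Let mE : measurable E := mU 0%N mA.
Let pE := fine (P E).

Let coef n k := \int[P]_(w in E) phi k (U n w).

Let past_E n : sigma_past U n E.
Proof.
by apply: sub_sigma_algebra; exists 0%N => //=; exists A => //; rewrite setTI.
Qed.

(** Each [U n] is uniform and [phi k] has norm one, so the quadratic bound gives [1], whatever
    [k]. *)
Let coef_le1 n k : `|coef n k| <= 1.
Proof.
apply: (le_trans (@normr_Rintegral_le_sqr _ _ _ P E setT (fun w => phi k (U n w))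
  (wgt R k) _ _ _ _ _ _)) => //.
- exact: Poo.
- by apply: measurableT_comp => //; exact: measurable_phi.
- by move=> w _; exact: phi_le.
have -> : fine (P setT) = 1 by rewrite probability_setT.
have -> : \int[P]_w (phi k (U n w) * phi k (U n w)) = 1; last by lra.
have := @chain_expectation n (fun x => phi k x * phi k x) (wgt R k * wgt R k) setT.
rewrite setTI phi_orthonormal eqxx preimage_setT; apply => //.
- by apply: measurable_funM; exact: measurable_phi.
- by move=> x; rewrite normrM ler_pM// phi_le.
Qed.

(** Index shift: this is the density of [U n.+1] on [E], written with the coefficients at time
    [n]. *)
Let dens n := lseries (fun k => l k ^+ 1 * coef n k).

Let dens_summable n : legendre_summable (fun k => l k ^+ 1 * coef n k).
Proof. by apply: (spectrum_summable hl) => // k; exact: coef_le1. Qed.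

(** On rays, [chain_step] gives the expectation of [ker v (U n)] on [E]; expanding it in [k]
    produces the same series as integrating [dens n] up to [v]. *)
Lemma joint_density n B : measurable B ->
  P (E `&` U n.+1 @^-1` B) =
  (\int[mu]_(x in B `&` `[0%R, 1%R]) (dens n x)%:E)%E.
Proof.
move=> mB; apply: (joint_law_density mE (measurable_lseries (@dens_summable n))
  (fun x => lseries_le x (@dens_summable n)) _ _ mB) => [S mS|v v01].
  exact: (chain_uniform hU).
rewrite (chain_step v01 (@past_E n) mE).
have -> : \int[P]_(w in E) ker v (U n w) = \int[mu]_(x in `[0, v]) dens n x.
  have h := integral_lseries_itv (@dens_summable n) v01.
  rewrite -(cvg_lim _ h)//; apply/esym/cvg_lim => //.
  rewrite (_ : (fun k => _) = (fun k => l k ^+ 1 * Phi k v * coef n k)).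
    apply: (@integral_lseries_cst _ _ _ P E (U n)) => //; first exact: Poo.
      exact: measurable_funTS.
    exact: ker_summable.
  by apply/funext => k; rewrite mulrAC.
rewrite /Rintegral fineK//; apply: integrable_fin_num => //.
apply: continuous_compact_integrable; first exact: segment_compact.
by apply: continuous_subspaceT => x; exact: continuous_lseries.
Qed.

(** Integrating [phi k] against [dens n] returns the [k]-th coefficient of that series. *)
Let coefS n k : coef n.+1 k = l k * coef n k.
Proof.
have := @Rintegral_joint_law _ _ _ P E mE (U n.+1) (dens n) (phi k) _ (wgt R k) setT
  (measurable_lseries (@dens_summable n))
  (fun x => lseries_le x (@dens_summable n))
  (@measurable_phi R k) (phi_le k) (@joint_density n) measurableT.
rewrite preimage_setT setIT setTI -/(coef n.+1 k) => ->.
have := legendre_coef k (@dens_summable n); rewrite expr1 => <-.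
by apply: eq_Rintegral => x _; rewrite mulrC.
Qed.

Let coefE n k : coef n k = l k ^+ n * coef 0 k.
Proof. by elim: n => [|n IH]; rewrite ?mul1r// coefS IH exprS mulrA. Qed.

Let coef00 : coef 0 0 = pE.
Proof.
rewrite /coef; under eq_Rintegral do rewrite phi0.
by rewrite Rintegral_cst// mul1r.
Qed.

(** Unlike [coef_le1], this keeps the factor [pE], which makes the final error relative to the
    product of probabilities, as in the definition of [psi]. *)
Let coef0_le k : `|coef 0 k| <= wgt R k * pE.
Proof.
have ip : P.-integrable E (EFin \o (fun w => phi k (U 0%N w))).
  apply: (bounded_integrable (M := wgt R k)) => //; first exact: Poo.
    by apply: measurable_funTS; apply: measurableT_comp => //; exact: measurable_phi.
  by move=> w _; exact: phi_le.
apply: le_trans (le_normr_Rintegral mE ip) _.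
rewrite /pE -Rintegral_cst//; apply: le_Rintegral => //.
- exact: integrable_norm.
- apply: (bounded_integrable (M := wgt R k)) => //; first exact: Poo.
  by move=> w _; rewrite ger0_norm// wgt_ge0.
- by move=> w _; exact: phi_le.
Qed.

(** The density is within [r ^ (n - 2) * pE] of [pE] at every point; integrate over [B]. *)
Lemma joint_density_bound n B : (1 < n)%N -> measurable B ->
  `|fine (P (E `&` U n @^-1` B)) - pE * fine (P (U 0%N @^-1` B))| <=
  r ^+ (n - 2) * (pE * fine (P (U 0%N @^-1` B))).
Proof.
case: n => [|n]// n1 mB; rewrite joint_density// (chain_uniform hU)//.
pose I : set (measurableTypeR R) := B `&` `[0, 1]%classic.
have mI : measurable I by apply: measurableI => //; exact: measurable_itv.
have Ioo : (mu I < +oo)%E.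
  rewrite /I -(chain_uniform hU 0%N mB); exact: Poo (mU _ mB).
have idens : mu.-integrable I (EFin \o dens n).
  apply: (bounded_integrable (M := limn (series (fun k =>
    `|l k ^+ 1 * coef n k| * wgt R k)))) => //.
    by apply: measurable_funTS; exact: measurable_lseries.
  by move=> x _; exact: lseries_le.
have ic (c : R) : mu.-integrable I (EFin \o (fun=> c)).
  by apply: (bounded_integrable (M := `|c|)).
have dE : (fun k => l k ^+ 1 * coef n k) = (fun k => l k ^+ n.+1 * coef 0 k).
  by apply/funext => k; rewrite coefE expr1 mulrA exprS.
have dle x : `|dens n x - pE| <= r ^+ (n.+1 - 2) * pE.
  rewrite /dens dE -coef00; apply: (lseries_spectrum_le hl) => // k _.
  by rewrite coef00 coef0_le.
have idc : mu.-integrable I (EFin \o (fun x => dens n x - pE)).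
  apply: (bounded_integrable (M := r ^+ (n.+1 - 2) * pE)) => //.
  apply: measurable_funB; last exact: measurable_cst.
  by apply: measurable_funTS; exact: measurable_lseries.
have h : `|\int[mu]_(x in I) (dens n x - pE)| <= \int[mu]_(x in I) (r ^+ (n.+1 - 2) * pE).
  apply: (le_trans (le_normr_Rintegral mI idc)).
  by apply: le_Rintegral => //; exact: integrable_norm.
by rewrite RintegralB// !Rintegral_cst// in h; rewrite mulrA; exact: h.
Qed.

End JointWithStart.

(** * Mixing coefficients of the chain *)

Lemma chain_dependence_bound n A B : (1 < n)%N -> measurable A -> measurable B ->
  `|Prn U n A B - Pr U A * Pr U B| <= r ^+ (n - 2) * (Pr U A * Pr U B).
Proof. by move=> n1 mA mB; exact: joint_density_bound. Qed.

Let expr_shift_cvg : r ^+ (n - 2) @[n --> \oo] --> 0.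
Proof.
have [_ /andP[r0 r1] _ _ _] := hl.
have r1' : `|r| < 1 by rewrite ger0_norm.
apply/cvgrPdist_le => e e0.
have [N _ hN] := (cvgrPdist_le _ _).1 (cvg_expr r1') _ e0.
by exists N.+2 => // n /= Nn; apply: hN => /=; lia.
Qed.

Let PrT : Pr U setT = 1.
Proof. by rewrite /Pr preimage_setT probability_setT. Qed.

Let PrnT n : Prn U n setT setT = 1.
Proof. by rewrite /Prn !preimage_setT setTI probability_setT. Qed.

(** The pair of full sets supplies the lower bounds of both squeezes: [0] for [psi] and [1] for
    [psi_star]. *)
Let nonnullT : nonnull_pairs U (setT, setT).
Proof. by split => //=; rewrite !PrT mulr1. Qed.

Lemma chain_psi_mixing : psi_mixing U.
Proof.
apply: (@squeeze_cvge _ _ _ _ (cst 0%E) _ (fun n => (r ^+ (n - 2))%:E)).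
- near=> n; have n1 : (1 < n)%N by near: n; exact: nbhs_infty_gt.
  apply/andP; split.
    apply: ereal_sup_ubound; exists (setT, setT); first exact: nonnullT.
    by rewrite /= PrnT PrT mulr1 subrr normr0 mul0r.
  apply: ub_ereal_sup => _ [[A B] [/= mA mB p0] <-].
  by rewrite lee_fin ler_pdivrMr// chain_dependence_bound.
- exact: cvg_cst.
- by apply: cvg_EFin; [exact: nearW|exact: expr_shift_cvg].
Unshelve. all: by end_near. Qed.

Lemma chain_psi_star_mixing : psi_star_mixing U.
Proof.
apply: (@squeeze_cvge _ _ _ _ (cst 1%E) _ (fun n => (1 + r ^+ (n - 2))%:E)).
- near=> n; have n1 : (1 < n)%N by near: n; exact: nbhs_infty_gt.
  apply/andP; split.
    apply: ereal_sup_ubound; exists (setT, setT); first exact: nonnullT.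
    by rewrite /= PrnT PrT mulr1 divr1.
  apply: ub_ereal_sup => _ [[A B] [/= mA mB p0] <-].
  rewrite lee_fin ler_pdivrMr//; have := chain_dependence_bound n1 mA mB.
  by rewrite ler_norml => /andP[_]; lra.
- exact: cvg_cst.
- apply: cvg_EFin; first exact: nearW.
  by rewrite -[X in _ --> X]addr0; apply: cvgD; [exact: cvg_cst|exact: expr_shift_cvg].
Unshelve. all: by end_near. Qed.

End ChainStep.

Theorem theorem3p3 (R : realType) (lambda : nat -> R) (C : R -> R -> R)
    (hl2 : (\sum_(1 <= k <oo) (lambda k ^+ 2)%:E < +oo)%E)
    (hsup : (ereal_sup [set `|lambda k|%:E | k in [set k | (1 <= k)%N]] < 1)%E)
    (hsum : (\sum_(1 <= k <oo)
               (`|lambda k| * (2 * k + 1)%N%:R * alpha R k)%:E <= 1)%E)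
    (hC : copula C)
    (hCform : legendre_copula lambda C) :
  (exists M : R, M < 2 /\
     exists N : nat, forall n : nat, (N <= n)%N ->
       exists c : measurableTypeR R * measurableTypeR R -> R, is_density c (copula_pow C n) /\
         exists g : measurableTypeR R * measurableTypeR R -> R, is_version g c /\
           forall z, unit_square z -> g z <= M)
  /\
  (forall (d : measure_display) (T : measurableType d) (P : probability T R)
     (U : nat -> {RV P >-> R}),
     chain_generated_by C U -> psi_star_mixing U /\ psi_mixing U).

Proof.
have [r hl] := spectrum_of_hypotheses hsup hsum.
split.
  (* The explicit density satisfies the bound everywhere, so it is taken as its own version. *)
  exists (3 / 2); split; first by lra.
  have [N hN] := copula_pow_density_le hl hCform; exists N => n Nn.
  have [dc le] := hN n Nn; exists (legendre_density lambda n); split => //.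
  exists (legendre_density lambda n); split; first exact: aeW.
  by move=> z _; exact: le.
move=> d T P U hU; split.
  exact: (chain_psi_star_mixing hl hCform hU).
exact: (chain_psi_mixing hl hCform hU).
Qed.
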